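(* Let $s>0$ and $d\in\mathbb{N}$, $d\ge2$. For all $n\in\mathbb{N}$ with $1\le n\le\frac d2 4^d$ it holds $$a_n(I_d:H^{s,\#}_{\rm mix}(\mathbb{T}^d)\to L_2(\mathbb{T}^d))\le\Big(\frac{e^2}{n}\Big)^{\frac{s}{2+\log_2 d}} .$$
   Context: $\mathbb{N}=\{1,2,3,\dots\}$. $\mathbb{T}^d$ is the $d$-torus, represented by $[0,2\pi]^d$ with opposite sides identified. $L_2(\mathbb{T}^d)$ carries the norm $\|f|L_2(\mathbb{T}^d)\|=(\int_{\mathbb{T}^d}|f(x)|^2dx)^{1/2}$, and for $f\in L_2(\mathbb{T}^d)$ the Fourier coefficients are $c_k(f)=(2\pi)^{-d/2}\int_{\mathbb{T}^d}f(x)e^{-ikx}dx$, $k\in\mathbb{Z}^d$ (so $\|f|L_2(\mathbb{T}^d)\|^2=\sum_k|c_k(f)|^2$). For $s>0$, $H^{s,\#}_{\rm mix}(\mathbb{T}^d)$ is the space of all $f\in L_2(\mathbb{T}^d)$ for which the norm $$\|f|H^s_{\rm mix}(\mathbb{T}^d)\|^{\#}=\Big[\sum_{k\in\mathbb{Z}^d}|c_k(f)|^2\prod_{j=1}^d(1+|k_j|)^{2s}\Big]^{1/2}$$ is finite, equipped with this norm. $I_d$ denotes the identical embedding $f\mapsto f$. The approximation numbers of a bounded linear operator $T:X\to Y$ between Banach spaces are $a_n(T:X\to Y)=\inf\{\|T-A:X\to Y\| : A:X\to Y \text{ bounded linear},\ {\rm rank}\,A<n\}$, $n\in\mathbb{N}$.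 *)

(* Defs.v *)
From HB Require Import structures.
From mathcomp Require Import all_boot all_order all_algebra generic_quotient ring_quotient.
From mathcomp Require Import all_classical all_reals all_analysis.
From mathcomp Require Import measurable_realfun complex ring lra.

Set Implicit Arguments.
Unset Strict Implicit.
Unset Printing Implicit Defensive.

Import Order.TTheory GRing.Theory Num.Theory.
Import numFieldNormedType.Exports.
Import Normc.

Local Open Scope classical_set_scope.
Local Open Scope ring_scope.
Local Open Scope complex_scope.
Local Open Scope quotient_scope.

Local Notation Re := complex.Re.
Local Notation Im := complex.Im.

Section approximation_numbers.
Context {R : realType}.
(* The norms are explicit arguments, so that they can take their values in R
   although the scalars are complex. *)
Context {X Y : lmodType R[i]} (nX : X -> R) (nY : Y -> R).

(* Extended-real valued, so that an unbounded operator has norm +oo rather than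
   a junk value; likewise the infimum below. *)
Definition opnorm (T : X -> Y) : \bar R :=
  ereal_sup [set (nY (T x))%:E | x in [set x | nX x <= 1]].

Definition bounded_op (T : X -> Y) : Prop :=
  exists M : R, forall x, nY (T x) <= M * nX x.

(* [V] is spanned by fewer than [n] of its elements. *)
Definition dim_lt (V : set Y) (n : nat) : Prop :=
  exists (m : nat) (e : 'I_m -> Y), [/\ (m < n)%N, forall i, V (e i) &
    forall y, V y -> exists c : 'I_m -> R[i], y = \sum_(i < m) c i *: e i].

Definition rank_lt (A : {linear X -> Y}) (n : nat) : Prop :=
  dim_lt (range A) n.

Definition approx_number (T : {linear X -> Y}) (n : nat) : \bar R :=
  ereal_inf [set opnorm (fun x => T x - A x) |
              A in [set A : {linear X -> Y} | bounded_op A /\ rank_lt A n]].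

End approximation_numbers.

(* T^d is represented by [0, 2 pi]^d: [torus_measure R d] is the restriction of
   the d-dimensional Lebesgue measure to this cube, viewed as a measure on all
   d-tuples of reals. It is the d-fold product of [circle_measure], transported
   along (x, t) |-> x :: t. Everything outside the cube, as well as the
   identified boundary faces, is negligible. *)
Section torus_measure.
Context {R : realType}.
Local Notation T := (measurableTypeR R).

Let circle_lty :
  (lebesgue_measure (`[0%R, (2 * pi)%R] : set T) < +oo :> \bar R)%E.
Proof. by rewrite lebesgue_measure_itv/=; case: ifP => _; rewrite ?ltry. Qed.

Definition circle_measure : {finite_measure set T -> \bar R} :=
  @mfrestr _ T R _ lebesgue_measure (measurable_itv `[0%R, (2 * pi)%R])
    circle_lty.

Section cons.
Variables (n : nat) (mu : {finite_measure set (n.-tuple T) -> \bar R}).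

Let consT (x : T * n.-tuple T) : n.+1.-tuple T := [the n.+1.-tuple T of x.1 :: x.2].

Let measurable_consT : measurable_fun [set: T * n.-tuple T] consT.
Proof. exact: measurable_cons. Qed.

HB.instance Definition _ :=
  isMeasurableFun.Build _ _ _ _ consT measurable_consT.

Let prodM := (circle_measure \x mu)%E.

Let map := pushforward prodM consT.

Let map0 : map set0 = 0%E. Proof. exact: measure0. Qed.

Let map_ge0 A : (0 <= map A)%E. Proof. exact: measure_ge0. Qed.

Let map_sigma_additive : semi_sigma_additive map.
Proof. exact: measure_semi_sigma_additive. Qed.

HB.instance Definition _ := isMeasure.Build _ _ _ map
  map0 map_ge0 map_sigma_additive.

Let map_fin : fin_num_fun map.
Proof.
apply: lty_fin_num_fun.
suff : (prodM setT < +oo)%E by [].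
rewrite /prodM -setXTT product_measure1E//.
by rewrite ltey_eq fin_numM// fin_num_measure.
Qed.

HB.instance Definition _ := Measure_isFinite.Build _ _ _ map map_fin.

Definition cons_measure : {finite_measure set (n.+1.-tuple T) -> \bar R} := map.

End cons.

Fixpoint torus_measure (d : nat) : {finite_measure set (d.-tuple T) -> \bar R} :=
  match d with
  | 0 => dirac ([tuple] : 0.-tuple T)
  | d'.+1 => cons_measure (torus_measure d')
  end.

End torus_measure.
Arguments torus_measure R d : clear implicits.

Section L2_torus.
Context {R : realType} {d : nat}.
Local Notation T := (d.-tuple (measurableTypeR R)).
Local Notation mu := (torus_measure R d).
Implicit Types f g : T -> R[i].

(* MathComp-Analysis integrates functions with values in R or \bar R only, so
   measurability and the integral of complex functions are taken through the
   real and imaginary parts; [normc] is the modulus, with values in R. *)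
Definition cmeasurable f : Prop :=
  measurable_fun [set: T] (fun x => Re (f x)) /\
  measurable_fun [set: T] (fun x => Im (f x)).

Definition square_integrable f : Prop :=
  cmeasurable f /\ (\int[mu]_x ((normc (f x)) ^+ 2)%:E < +oo)%E.

Definition cintegral f : R[i] :=
  (\int[mu]_x Re (f x)) +i* (\int[mu]_x Im (f x)).

Definition kdot (k : d.-tuple int) (x : T) : R :=
  \sum_(j < d) (tnth k j)%:~R * tnth x j.

(* The second factor under the integral is e^{-ikx}. *)
Definition fourier_coef (k : d.-tuple int) f : R[i] :=
  ((2 * pi) `^ (- (d%:R / 2)))%:C *
  cintegral (fun x => f x * (cos (kdot k x) -i* sin (kdot k x))).

Lemma normc_sqr (z : R[i]) : normc z ^+ 2 = Re z ^+ 2 + Im z ^+ 2.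
Proof. by case: z => a b /=; rewrite sqr_sqrtr// addr_ge0// sqr_ge0. Qed.

Lemma measurable_normc_sqr f : cmeasurable f ->
  measurable_fun [set: T] (fun x => (normc (f x) ^+ 2)%:E).
Proof.
move=> [mr mi]; apply/measurable_EFinP.
rewrite (_ : (fun x => _) = (fun x => Re (f x) ^+ 2 + Im (f x) ^+ 2)).
  by apply: measurable_funD; apply: measurable_funX.
by apply/funext => x; rewrite normc_sqr.
Qed.

Lemma cmeasurableD f g : cmeasurable f -> cmeasurable g ->
  cmeasurable (fun x => f x + g x).
Proof.
move=> [fr fi] [gr gi]; split.
  rewrite (_ : (fun x => _) = (fun x => Re (f x) + Re (g x))).
    exact: measurable_funD.
  by apply/funext => x; case: (f x) => ? ?; case: (g x).
rewrite (_ : (fun x => _) = (fun x => Im (f x) + Im (g x))).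
  exact: measurable_funD.
by apply/funext => x; case: (f x) => ? ?; case: (g x).
Qed.

Lemma cmeasurableM f g : cmeasurable f -> cmeasurable g ->
  cmeasurable (fun x => f x * g x).
Proof.
move=> [fr fi] [gr gi]; split.
  rewrite (_ : (fun x => _) =
    (fun x => Re (f x) * Re (g x) - Im (f x) * Im (g x))).
    by apply: measurable_funB; apply: measurable_funM.
  by apply/funext => x; case: (f x) => ? ?; case: (g x).
rewrite (_ : (fun x => _) =
    (fun x => Re (f x) * Im (g x) + Im (f x) * Re (g x))).
  by apply: measurable_funD; apply: measurable_funM.
by apply/funext => x; case: (f x) => ? ?; case: (g x).
Qed.

Lemma cmeasurable_cst (c : R[i]) : cmeasurable (fun=> c).
Proof. by split; exact: measurable_cst. Qed.

Lemma normcD_sqr (a b : R[i]) :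
  normc (a + b) ^+ 2 <= 2 * normc a ^+ 2 + 2 * normc b ^+ 2.
Proof.
rewrite !normc_sqr; case: a => a1 a2; case: b => b1 b2 /=.
have := sqr_ge0 (a1 - b1); have := sqr_ge0 (a2 - b2); nra.
Qed.

Lemma square_integrableD f g : square_integrable f -> square_integrable g ->
  square_integrable (fun x => f x + g x).
Proof.
move=> [mf fi] [mg gi]; split; first exact: cmeasurableD.
apply: (@le_lt_trans _ _ (\int[mu]_x
    (2%:E * (normc (f x) ^+ 2)%:E + 2%:E * (normc (g x) ^+ 2)%:E)))%E.
  apply: ge0_le_integral => //.
  - by move=> x _; rewrite lee_fin sqr_ge0.
  - exact: measurable_normc_sqr (cmeasurableD mf mg).
  - by apply: emeasurable_funD; apply: measurable_funeM;
      exact: measurable_normc_sqr.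
  - by move=> x _; rewrite lee_fin normcD_sqr.
rewrite ge0_integralD//; last 4 first.
- by move=> x _; rewrite -EFinM lee_fin mulr_ge0// sqr_ge0.
- by apply: measurable_funeM; exact: measurable_normc_sqr.
- by move=> x _; rewrite -EFinM lee_fin mulr_ge0// sqr_ge0.
- by apply: measurable_funeM; exact: measurable_normc_sqr.
rewrite !ge0_integralZl//; last 4 first.
- exact: measurable_normc_sqr.
- by move=> x _; rewrite lee_fin sqr_ge0.
- exact: measurable_normc_sqr.
- by move=> x _; rewrite lee_fin sqr_ge0.
by rewrite lte_add_pinfty// lte_mul_pinfty.
Qed.

Lemma square_integrableZ (a : R[i]) f : square_integrable f ->
  square_integrable (fun x => a * f x).
Proof.
move=> [mf fi]; split; first exact: cmeasurableM (cmeasurable_cst a) mf.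
under eq_integral do rewrite normcM exprMn EFinM.
rewrite ge0_integralZl//; last 3 first.
- exact: measurable_normc_sqr.
- by move=> x _; rewrite lee_fin sqr_ge0.
- by rewrite lee_fin sqr_ge0.
by rewrite lte_mul_pinfty// lee_fin sqr_ge0.
Qed.

Lemma square_integrable0 : square_integrable (fun=> 0).
Proof.
split; first exact: cmeasurable_cst.
by under eq_integral do rewrite normc0 expr0n/=; rewrite integral0 ltry.
Qed.

Definition L2fun_pred : {pred T -> R[i]} := [pred f | `[< square_integrable f >]].

Lemma L2fun_submod_closed : submod_closed L2fun_pred.
Proof.
split; first exact/asboolP/square_integrable0.
move=> a f g /asboolP fi /asboolP gi; apply/asboolP.
exact: square_integrableD (square_integrableZ a fi) gi.
Qed.

HB.instance Definition _ :=
  GRing.isSubmodClosed.Build _ _ L2fun_pred L2fun_submod_closed.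

Record L2fun := MkL2fun { L2fun_val :> T -> R[i]; _ : L2fun_val \in L2fun_pred }.

HB.instance Definition _ := [isSub for L2fun_val].
HB.instance Definition _ := [Choice of L2fun by <:].
HB.instance Definition _ := [SubChoice_isSubLmodule of L2fun by <:].

Definition L2null : {pred L2fun} :=
  [pred f : L2fun | `[< {ae mu, forall x, L2fun_val f x = 0} >]].

Lemma L2null_zmod_closed : zmod_closed L2null.
Proof.
split; first by apply/asboolP; apply: aeW.
move=> f g /asboolP f0 /asboolP g0; apply/asboolP.
by apply: filterS2 f0 g0 => x /= f0 g0; rewrite /= !fctE f0 g0 subr0.
Qed.

HB.instance Definition _ := GRing.isZmodClosed.Build _ L2null L2null_zmod_closed.

(* Square-integrable functions modulo equality almost everywhere. *)
Definition L2 : Type := Quotient.quot L2null.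

HB.instance Definition _ := Choice.on L2.
HB.instance Definition _ := GRing.Zmodule.on L2.
HB.instance Definition _ := EqQuotient.on L2.

Lemma L2_eqP (f g : L2fun) :
  reflect {ae mu, forall x, f x = g x} (f == g %[mod L2]).
Proof.
rewrite -[X in reflect _ X](Quotient.idealrBE L2null f g).
apply: (iffP (asboolP _)); apply: filterS => x; rewrite /= !fctE.
  by move/eqP; rewrite subr_eq0 => /eqP.
by move=> ->; rewrite subrr.
Qed.

Lemma repr_piE (f : L2fun) : {ae mu, forall x, repr (\pi_L2 f) x = f x}.
Proof. by apply/L2_eqP/eqP; rewrite reprK. Qed.

Definition L2_scale (a : R[i]) (u : L2) : L2 := \pi_L2 (a *: repr u).

Lemma pi_scale a (f : L2fun) : L2_scale a (\pi_L2 f) = \pi_L2 (a *: f).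
Proof.
apply/eqP/L2_eqP; apply: filterS (repr_piE f) => x /= fx.
by rewrite !fctE fx.
Qed.

Lemma pi_L2D (f g : L2fun) : \pi_L2 (f + g) = \pi_L2 f + \pi_L2 g.
Proof. exact: (Quotient.pi_add L2null). Qed.

Lemma L2_scalerA a b u : L2_scale a (L2_scale b u) = L2_scale (a * b) u.
Proof. by rewrite -[u]reprK !pi_scale scalerA ?reprK. Qed.

Lemma L2_scale1r : left_id 1 L2_scale.
Proof. by move=> u; rewrite -[u]reprK pi_scale scale1r. Qed.

Lemma L2_scalerDr : right_distributive L2_scale +%R.
Proof.
by move=> a u v; rewrite -[u]reprK -[v]reprK -pi_L2D !pi_scale scalerDr pi_L2D.
Qed.

Lemma L2_scalerDl u : {morph L2_scale^~ u : a b / a + b}.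
Proof. by move=> a b; rewrite -[u]reprK !pi_scale scalerDl pi_L2D. Qed.

HB.instance Definition _ := GRing.Zmodule_isLmodule.Build R[i] L2
  L2_scalerA L2_scale1r L2_scalerDr L2_scalerDl.

Definition L2norm (u : L2) : R :=
  Num.sqrt (\int[mu]_x (normc (repr u x) ^+ 2)).

Lemma repr_L2D (u v : L2) : {ae mu, forall x, repr (u + v) x = repr u x + repr v x}.
Proof.
by have := repr_piE (repr u + repr v); rewrite pi_L2D !reprK.
Qed.

Lemma repr_L2Z a (u : L2) : {ae mu, forall x, repr (a *: u) x = a * repr u x}.
Proof. exact: (repr_piE (a *: repr u)). Qed.

Definition cintegrable f : Prop :=
  mu.-integrable [set: T] (fun x => (Re (f x))%:E) /\
  mu.-integrable [set: T] (fun x => (Im (f x))%:E).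

Lemma cintegralD f g : cintegrable f -> cintegrable g ->
  cintegral (fun x => f x + g x) = cintegral f + cintegral g.
Proof.
move=> [fr fi] [gr gi]; rewrite /cintegral.
transitivity ((\int[mu]_x (Re (f x) + Re (g x))) +i*
              (\int[mu]_x (Im (f x) + Im (g x)))).
  by congr (_ +i* _); apply: eq_Rintegral => x _;
    case: (f x) => ? ?; case: (g x).
by rewrite !RintegralD.
Qed.

Lemma cintegralZ (a : R[i]) f : cintegrable f ->
  cintegral (fun x => a * f x) = a * cintegral f.
Proof.
move=> [fr fi]; rewrite /cintegral; case: a => a1 a2.
transitivity ((\int[mu]_x (a1 * Re (f x) - a2 * Im (f x))) +i*
              (\int[mu]_x (a1 * Im (f x) + a2 * Re (f x)))).
  by congr (_ +i* _); apply: eq_Rintegral => x _; case: (f x).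
have intZ (c : R) (h : T -> R) : mu.-integrable [set: T] (EFin \o h) ->
    mu.-integrable [set: T] (EFin \o (fun x => c * h x)).
  by move=> ih; rewrite -[EFin \o _]/(fun x => (c%:E * (h x)%:E)%E);
      exact: integrableZl.
rewrite RintegralB ?RintegralD//; try exact: intZ.
by rewrite !RintegralZl.
Qed.

Lemma ae_eq_cintegral f g : cmeasurable f -> cmeasurable g ->
  {ae mu, forall x, f x = g x} -> cintegral f = cintegral g.
Proof.
move=> [fr fi] [gr gi] fg; congr (_ +i* _); congr fine;
  apply: ae_eq_integral => //; try (by apply/measurable_EFinP);
  by apply: filterS fg => x fgx _; rewrite fgx.
Qed.

Lemma cmeasurable_char k :
  cmeasurable (fun x => cos (kdot k x) -i* sin (kdot k x)).
Proof.
have mk : measurable_fun [set: T] (kdot k).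
  apply: measurable_sum => j; apply: measurable_funM => //.
  exact: measurable_tnth.
split => /=.
  by apply: measurableT_comp => //; apply: continuous_measurable_fun => ?;
    exact: continuous_cos.
apply: measurableT_comp => //; apply: measurableT_comp => //.
by apply: continuous_measurable_fun => ?; exact: continuous_sin.
Qed.

Lemma square_integrable_char k f : square_integrable f ->
  square_integrable (fun x => f x * (cos (kdot k x) -i* sin (kdot k x))).
Proof.
move=> [mf fi]; split; first exact: cmeasurableM mf (cmeasurable_char k).
apply: le_lt_trans fi; rewrite le_eqVlt; apply/orP; left; apply/eqP.
apply: eq_integral => x _.
by rewrite normcM /= sqrrN cos2Dsin2 sqrtr1 mulr1.
Qed.

Lemma square_integrable_cintegrable f : square_integrable f -> cintegrable f.
Proof.
move=> [mf fi].
have ib : mu.-integrable [set: T] (fun x => (1 + normc (f x) ^+ 2)%:E).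
  under eq_fun do rewrite EFinD; apply: integrableD => //.
    exact: finite_measure_integrable_cst.
  apply/integrableP; split; first exact: measurable_normc_sqr.
  by under eq_integral do rewrite gee0_abs ?lee_fin ?sqr_ge0//.
have [mr mi] := mf.
split; apply: le_integrable ib => //; try exact/measurable_EFinP.
- move=> x _; rewrite lee_fin normc_sqr [leRHS]ger0_norm.
    by rewrite ler_norml; apply/andP; split;
      have := sqr_ge0 (Re (f x)); have := sqr_ge0 (Im (f x));
      have := sqr_ge0 (Re (f x) - 1); have := sqr_ge0 (Re (f x) + 1); nra.
  by rewrite addr_ge0// addr_ge0// sqr_ge0.
- move=> x _; rewrite lee_fin normc_sqr [leRHS]ger0_norm.
    by rewrite ler_norml; apply/andP; split;
      have := sqr_ge0 (Re (f x)); have := sqr_ge0 (Im (f x));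
      have := sqr_ge0 (Im (f x) - 1); have := sqr_ge0 (Im (f x) + 1); nra.
  by rewrite addr_ge0// addr_ge0// sqr_ge0.
Qed.

Lemma square_integrableP (f : L2fun) : square_integrable f.
Proof. exact/asboolP/(valP f). Qed.

(* Independent of the representative, by [ae_eq_cintegral]. *)
Definition L2coef (k : d.-tuple int) (u : L2) : R[i] := fourier_coef k (repr u).

Lemma L2coefD k u v : L2coef k (u + v) = L2coef k u + L2coef k v.
Proof.
rewrite /L2coef /fourier_coef -mulrDr; congr (_ * _).
rewrite -cintegralD; try by apply: square_integrable_cintegrable;
  apply: square_integrable_char; exact: square_integrableP.
apply: ae_eq_cintegral.
- by have [] := square_integrable_char k (square_integrableP (repr (u + v))).
- by apply: cmeasurableD;
    [have [] := square_integrable_char k (square_integrableP (repr u))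
    |have [] := square_integrable_char k (square_integrableP (repr v))].
- by apply: filterS (repr_L2D u v) => x ->; rewrite mulrDl.
Qed.

Lemma L2coefZ k a u : L2coef k (a *: u) = a * L2coef k u.
Proof.
rewrite /L2coef /fourier_coef mulrCA; congr (_ * _).
rewrite -cintegralZ; last by apply: square_integrable_cintegrable;
  apply: square_integrable_char; exact: square_integrableP.
apply: ae_eq_cintegral.
- by have [] := square_integrable_char k (square_integrableP (repr (a *: u))).
- by apply: cmeasurableM; [exact: cmeasurable_cst
    |have [] := square_integrable_char k (square_integrableP (repr u))].
- by apply: filterS (repr_L2Z a u) => x ->; rewrite mulrA.
Qed.

End L2_torus.
Arguments L2 R d : clear implicits.

Section mixed_space.
Context {R : realType} {d : nat} (s : R).
Implicit Types (k : d.-tuple int) (u v : L2 R d).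

Definition Hmix_term u k : \bar R :=
  (normc (L2coef k u) ^+ 2 *
   \prod_(j < d) (1 + `|tnth k j|%:~R) `^ (2 * s))%:E.

Definition Hmix_sum u : \bar R :=
  \esum_(k in [set: d.-tuple int]) Hmix_term u k.

Lemma Hmix_term_ge0 u k : (0 <= Hmix_term u k)%E.
Proof. by rewrite lee_fin mulr_ge0 ?sqr_ge0// prodr_ge0// => j _; exact: powR_ge0. Qed.

Lemma Hmix_termD u v k : (Hmix_term (u + v)%R k <=
  (Hmix_term u k + Hmix_term u k) + (Hmix_term v k + Hmix_term v k))%E.
Proof.
rewrite /Hmix_term -!EFinD lee_fin L2coefD.
set w := \prod_(j < d) _.
have w0 : 0 <= w by apply: prodr_ge0 => j _; exact: powR_ge0.
have := ler_wpM2r w0 (normcD_sqr (L2coef k u) (L2coef k v)); lra.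
Qed.

Lemma Hmix_sumD u v : (Hmix_sum u < +oo)%E -> (Hmix_sum v < +oo)%E ->
  (Hmix_sum (u + v)%R < +oo)%E.
Proof.
move=> fu fv; apply: (@le_lt_trans _ _
  ((Hmix_sum u + Hmix_sum u) + (Hmix_sum v + Hmix_sum v))%E).
  rewrite /Hmix_sum -!esumD; try by move=> *; rewrite ?adde_ge0 ?Hmix_term_ge0.
  by apply: le_esum => k _; exact: Hmix_termD.
by rewrite !lte_add_pinfty.
Qed.

Lemma Hmix_sumZ a u : (Hmix_sum u < +oo)%E -> (Hmix_sum (a *: u)%R < +oo)%E.
Proof.
move=> fu; apply: (@le_lt_trans _ _ ((normc a ^+ 2)%:E * Hmix_sum u)%E).
  apply: ub_ereal_sup => _ [F FT <-].
  have -> : (\sum_(k \in F) Hmix_term (a *: u)%R k =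
      (normc a ^+ 2)%:E * \sum_(k \in F) Hmix_term u k)%E.
    rewrite ge0_mule_fsumr; last by move=> k; exact: Hmix_term_ge0.
    by apply: eq_fsbigr => k _; rewrite /Hmix_term -EFinM L2coefZ normcM exprMn -mulrA.
  rewrite lee_wpmul2l ?lee_fin ?sqr_ge0//.
  by apply: ereal_sup_ubound; exists F.
by rewrite lte_mul_pinfty// lee_fin sqr_ge0.
Qed.

Definition Hmix_pred : {pred L2 R d} := [pred u | (Hmix_sum u < +oo)%E].

Lemma Hmix_submod_closed : submod_closed Hmix_pred.
Proof.
split.
  rewrite inE -(scale0r (0 : L2 R d)) /Hmix_sum esum1 ?ltry// => k _.
  by rewrite /Hmix_term L2coefZ mul0r normc0 expr0n mul0r.
by move=> a u v; rewrite !inE => fu fv; apply: Hmix_sumD => //; exact: Hmix_sumZ.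
Qed.

HB.instance Definition _ :=
  GRing.isSubmodClosed.Build _ _ Hmix_pred Hmix_submod_closed.

Record Hmix := MkHmix { Hmix_val : L2 R d; _ : Hmix_val \in Hmix_pred }.

HB.instance Definition _ := [isSub for Hmix_val].
HB.instance Definition _ := [Choice of Hmix by <:].
HB.instance Definition _ := [SubChoice_isSubLmodule of Hmix by <:].

Definition Hmix_norm (u : Hmix) : R := Num.sqrt (fine (Hmix_sum (Hmix_val u))).

Definition Hmix_embedding : {linear Hmix -> L2 R d} := \val.

End mixed_space.
Arguments Hmix {R} d s.
Arguments Hmix_embedding {R} d s.

(* Main.v *)
(** Write [w(k) = prod_j (1 + |k_j|)].  Truncating the Fourier series to the
    hyperbolic cross [w(k) < r] is an operator whose rank is the number of such
    [k], and by Parseval its error is at most [r^-s].  The cardinality is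
    bounded by Rankin's trick: with [a = 2 + log_2 d] one has [2^-a = 1 / (4d)],
    hence [sum_{m in Z} (1 + |m|)^-a < 1 + 2/d], and so
      #{k | w(k) < r} <= r^a * (sum_m (1 + |m|)^-a)^d < e^2 r^a.
    Choosing [e^2 r^a = n] gives the bound.

    Parseval is needed in the form [||f||^2 <= sum_k |c_k(f)|^2], that is,
    density of trigonometric polynomials in L_2.  The sets whose indicator is
    an almost everywhere limit of trigonometric polynomials with values in
    [0, 1] form a pi-system containing the half-spaces [a < x_j], so the
    pi-lambda theorem applies. *)
Require Import Defs.
From HB Require Import structures.
From mathcomp Require Import all_boot all_order all_algebra.
From mathcomp Require Import all_classical all_reals all_analysis.
From mathcomp Require Import measurable_realfun complex ring lra.

Set Implicit Arguments.
Unset Strict Implicit.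
Unset Printing Implicit Defensive.

Import Order.TTheory GRing.Theory Num.Theory.
Import numFieldNormedType.Exports.
Import Normc.

Local Open Scope classical_set_scope.
Local Open Scope ring_scope.
Local Open Scope complex_scope.

Local Notation Re := complex.Re.
Local Notation Im := complex.Im.

(** * Cardinality of hyperbolic crosses *)

Section counting.
Context {R : realType}.

Lemma prodr_powR (I : Type) (s : seq I) (F : I -> R) (a : R) :
  (forall i, 0 <= F i) -> \prod_(i <- s) (F i `^ a) = (\prod_(i <- s) F i) `^ a.
Proof.
move=> F0; elim: s => [|i s IH]; first by rewrite !big_nil powR1.
by rewrite !big_cons IH powRM// prodr_ge0.
Qed.

(* Enumerates the integers of absolute value at most [M]. *)
Definition int_of_box (M : nat) (i : 'I_(M.+1 + M)) : int :=
  match fintype.split i with inl a => Posz a | inr b => Negz b end.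

Lemma int_of_box_inj M : injective (@int_of_box M).
Proof.
move=> i j; rewrite /int_of_box -{2}(splitK i) -{2}(splitK j).
by case: (fintype.split i) => a; case: (fintype.split j) => b //= [] ab; congr (_ _); apply: val_inj.
Qed.

Lemma int_of_box_onto M (k : int) : (`|k| <= M%:Z) ->
  exists i : 'I_(M.+1 + M), int_of_box i = k.
Proof.
case: k => m km.
  have mM : (m < M.+1)%N by rewrite ltnS -lez_nat.
  by exists (unsplit (inl (Ordinal mM))); rewrite /int_of_box unsplitK.
have mM : (m < M)%N by move: km; rewrite NegzE normrN -lez_nat.
by exists (unsplit (inr (Ordinal mM))); rewrite /int_of_box unsplitK.
Qed.

(** Telescoping comparison [1/(b+2)^2 <= 1/(b+1) - 1/(b+2)]; the induction carries the sharper bound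
    [1 - 1/(M+1)]. *)
Lemma sum_inv_square_lt1 (M : nat) : \sum_(b < M) (b.+2%:R ^- 2 : R) < 1.
Proof.
suff : \sum_(b < M) (b.+2%:R ^- 2 : R) <= 1 - M.+1%:R^-1.
  by move=> /le_lt_trans; apply; rewrite ltrBlDr ltrDl invr_gt0 ltr0n.
elim: M => [|M IH]; first by rewrite big_ord0 invr1 subrr.
rewrite big_ord_recr /=; apply: (le_trans (lerD IH (lexx _))).
have -> : M.+2%:R = M.+1%:R + 1 :> R by rewrite -[in LHS]addn1 natrD.
have x0 : 0 < M.+1%:R :> R by rewrite ltr0n.
set x : R := M.+1%:R in x0 *.
rewrite -subr_ge0.
have -> : 1 - (x + 1)^-1 - (1 - x^-1 + (x + 1) ^- 2) = (x * (x + 1) ^+ 2)^-1.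
  by field; rewrite !gt_eqF//; lra.
by rewrite invr_ge0 mulr_ge0 ?sqr_ge0// ltW.
Qed.

(** The integer 0 contributes 1 and each sign contributes less than [1/d]: since [a >= 2] and
    [2^-a = 1/(4d)], a base [m >= 2] satisfies [m^-a <= 2^-a (m/2)^-2 = m^-2 / d], and the inverse
    squares from 2 on sum to less than 1. *)
Lemma sum_box_lt (d M : nat) : (0 < d)%N ->
  \sum_(i < M.+1 + M)
    (1 + `|int_of_box i|%:~R : R) `^ (- (2 + ln d%:R / ln 2)) < 1 + 2 / d%:R.
Proof.
move=> d0; set a := 2 + _.
have d0R : 0 < d%:R :> R by rewrite ltr0n.
have d1R : 1 <= d%:R :> R by rewrite ler1n.
have ln20 : 0 < ln 2 :> R by apply: ln_gt0; lra.
have a2 : 2 <= a by rewrite lerDl; apply: divr_ge0; [exact: ln_ge0|exact: ltW].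
have p2 : 2 `^ (- a) = (4 * d%:R)^-1 :> R.
  rewrite powRN; congr (_ ^-1); rewrite powRD; last by apply/implyP => _; lra.
  congr (_ * _); first by rewrite powR_mulrn; lra.
  rewrite /powR pnatr_eq0 /= divfK ?gt_eqF// lnK//. 
rewrite big_split_ord /= big_ord_recl /=.
(* The positive entry [b.+1] and the negative entry [Negz b] have the same base [b+2], so the two
   halves are one and the same sum. *)
have E1 (b : 'I_M) : (1 + `|int_of_box (lshift M (lift ord0 b))|%:~R : R) = b.+2%:R.
  by rewrite /int_of_box (unsplitK (inl _)) /= -[in RHS]add1n natrD.
have E2 (b : 'I_M) : (1 + `|int_of_box (rshift M.+1 b)|%:~R : R) = b.+2%:R.
  by rewrite /int_of_box (unsplitK (inr _)) NegzE normrN /= -[in RHS]add1n natrD.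
rewrite (eq_bigr _ (fun b _ => congr1 (fun x => x `^ (- a)) (E1 b))).
rewrite (eq_bigr _ (fun b _ => congr1 (fun x => x `^ (- a)) (E2 b))).
have -> : int_of_box (lshift M (ord0 : 'I_M.+1)) = 0.
  by rewrite /int_of_box (unsplitK (inl _)).
rewrite normr0 addr0 powR1.
suff le_sum : \sum_(b < M) (b.+2%:R : R) `^ (- a) <= d%:R^-1 * \sum_(b < M) b.+2%:R ^- 2.
  have := sum_inv_square_lt1 M.
  rewrite -(ltr_pM2l (_ : 0 < d%:R^-1)) ?invr_gt0// mulr1 => lt_sum.
  by have := le_lt_trans le_sum lt_sum; lra.
rewrite mulr_sumr; apply: ler_sum => b _.
(* Splitting off the factor 2 keeps [2^-a] exact, while [y >= 1] allows the exponent [-a] to be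
   relaxed to [-2]. *)
have -> : (b.+2%:R : R) = 2 * (b.+2%:R / 2) by field.
set y : R := _ / 2.
have y1 : 1 <= y by rewrite /y ler_pdivlMr ?mul1r ?ler_nat.
have y0 : 0 < y by lra.
rewrite powRM; [|lra|lra].
have : y `^ (- a) <= y `^ (-2) by apply: ler_powR; rewrite // lerN2.
have -> : y `^ (-2) = y ^- 2 by rewrite powRN powR_mulrn ?ltW.
rewrite p2 => yle.
have -> : d%:R^-1 * (2 * y) ^- 2 = (4 * d%:R)^-1 * y ^- 2.
  by field; rewrite !gt_eqF.
by rewrite ler_pM2l// invr_gt0 mulr_gt0.
Qed.

Lemma hyperbolic_cross_card (d : nat) (r : R) : (0 < d)%N -> 0 < r ->
  exists F : seq (d.-tuple int), [/\ uniq F,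
    forall k, (k \in F) = (\prod_(j < d) (1 + `|tnth k j|%:~R) < r) &
    (size F)%:R < expR 2 * r `^ (2 + ln d%:R / ln 2)].
Proof.
move=> d0 r0; set a := 2 + _.
have d0R : 0 < d%:R :> R by rewrite ltr0n.
(* All factors of [w k] are at least 1, so [w k < r] bounds every single [|k_j|] by [M]; the cross
   lies in a finite box, indexed by [I]. *)
pose M := Num.truncn r.
pose I := {ffun 'I_d -> 'I_(M.+1 + M)}.
pose tup (f : I) := [tuple int_of_box (f j) | j < d].
pose w (k : d.-tuple int) : R := \prod_(j < d) (1 + `|tnth k j|%:~R).
have tup_inj : injective tup.
  move=> f g fg; apply/ffunP => j; apply: int_of_box_inj.
  by have := congr1 (fun t => tnth t j) fg; rewrite !tnth_mktuple.
have fac_ge1 (k : d.-tuple int) j : 1 <= 1 + `|tnth k j|%:~R :> R.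
  by rewrite lerDl ler0z.
have w_gt0 k : 0 < w k.
  by apply: prodr_gt0 => j _; exact: lt_le_trans ltr01 (fac_ge1 k j).
exists [seq tup f | f <- enum I & w (tup f) < r]; split.
- by rewrite map_inj_uniq// filter_uniq// enum_uniq.
- move=> k; apply/mapP/idP => [[f]|kr].
    by rewrite mem_filter => /andP[wr _] ->.
  have kM j : `|tnth k j| <= M%:Z.
    rewrite -(ler_int R).
    have : `|tnth k j|%:~R + 1 <= w k.
      rewrite /w (bigD1 j)//= addrC ler_peMr//.
      elim/big_ind: _ => [|x y|i _]; [exact: lexx|exact: mulr_ege1|exact: fac_ge1].
    move=> /le_lt_trans/(_ kr)/lt_trans/(_ (truncnS_gt r)).
    rewrite -addn1 natrD ltrD2r => /ltW.
    by rewrite pmulrn.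
  have /fin_all_exists[f fE] j := int_of_box_onto (kM j).
  exists [ffun j => f j]; last first.
    by apply: eq_from_tnth => j; rewrite tnth_mktuple ffunE fE.
  rewrite mem_filter mem_enum andbT.
  suff -> : tup [ffun j => f j] = k by [].
  by apply: eq_from_tnth => j; rewrite tnth_mktuple ffunE fE.
rewrite size_map size_filter.
have -> : (count (fun f => w (tup f) < r) (enum I))%:R =
    \sum_(f : I | w (tup f) < r) 1 :> R.
  by rewrite -sum1_count natr_sum big_enum_cond.
(* Each counted [f] has [1 <= r^a w^-a]. Adding the nonnegative terms outside the cross gives a sum
   over the whole box, which factors into a [d]-th power by distributivity. *)
apply: (@le_lt_trans _ _ (r `^ a *
    (\sum_(i < M.+1 + M) (1 + `|int_of_box i|%:~R : R) `^ (- a)) ^+ d)).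
  rewrite -[X in _ ^+ X](card_ord d) -prodr_const bigA_distr_bigA /=.
  rewrite mulr_sumr [leRHS](bigID (fun f : I => w (tup f) < r)) /=.
  rewrite -[leLHS]addr0; apply: lerD; last first.
    apply: sumr_ge0 => f _; rewrite mulr_ge0 ?powR_ge0//.
    by apply: prodr_ge0 => j _; exact: powR_ge0.
  apply: ler_sum => f fr.
  have -> : \prod_(j < d) (1 + `|int_of_box (f j)|%:~R : R) `^ (- a) =
      w (tup f) `^ (- a).
    rewrite /w -prodr_powR => [|j]; last exact: le_trans ler01 (fac_ge1 _ j).
    by apply: eq_bigr => j _; rewrite tnth_mktuple.
  rewrite powRN ler_pdivlMr ?mul1r ?powR_gt0//.
  apply: ge0_ler_powR; rewrite ?nnegrE ?ltW//.
  have ln20 : 0 < ln 2 :> R by apply: ln_gt0; lra.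
  have : 0 <= ln d%:R / ln 2 :> R.
    by apply: divr_ge0; [apply: ln_ge0; rewrite ler1n|exact: ltW].
  by rewrite /a; lra.
rewrite [ltRHS]mulrC ltr_pM2l ?powR_gt0//.
(* The inequality [1 + x <= exp x] at [x = 2/d], raised to the power [d], produces the constant
   [e^2]. *)
apply: (@lt_le_trans _ _ ((1 + 2 / d%:R) ^+ d)).
  have S0 : 0 <= \sum_(i < M.+1 + M) (1 + `|int_of_box i|%:~R : R) `^ (- a).
    by apply: sumr_ge0 => i _; exact: powR_ge0.
  by rewrite ltrXn2r ?gtn_eqF//= ?sum_box_lt//.
have -> : expR 2 = expR (2 / d%:R) ^+ d :> R.
  by rewrite -expRM_natl; congr expR; field; rewrite gt_eqF.
by rewrite lerXn2r ?nnegrE ?expR_ge1Dx ?expR_ge0// addr_ge0// divr_ge0.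
Qed.
End counting.

(** * Density of trigonometric polynomials *)

Section trig_poly.
Context {R : realType} {d : nat}.
Local Notation T := (d.-tuple (measurableTypeR R)).
Implicit Types (f g t u : T -> R[i]) (k l : d.-tuple int).

Definition torus_char k : T -> R[i] := fun x => cos (kdot k x) +i* sin (kdot k x).

(** The list may repeat a frequency, so that sums are concatenations and products are lists of
    pairs. *)
Definition trig_poly t : Prop := exists s : seq (d.-tuple int * R[i]),
  forall x, t x = \sum_(p <- s) p.2 * torus_char p.1 x.

Lemma kdotD k l (x : T) :
  kdot [tuple tnth k j + tnth l j | j < d] x = kdot k x + kdot l x.
Proof.
rewrite /kdot -big_split; apply: eq_bigr => j _.
by rewrite tnth_mktuple intrD mulrDl.
Qed.

Lemma torus_charM k l x : torus_char [tuple tnth k j + tnth l j | j < d] x =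
  torus_char k x * torus_char l x.
Proof.
rewrite /torus_char kdotD cosD sinD; apply/eqP; rewrite eq_complex /=.
by rewrite eqxx addrC /=.
Qed.

Lemma torus_char0 x : torus_char [tuple 0 | j < d] x = 1.
Proof.
rewrite /torus_char /kdot big1 ?cos0 ?sin0// => j _.
by rewrite tnth_mktuple mul0r.
Qed.

Lemma trig_poly_char k : trig_poly (torus_char k).
Proof. by exists [:: (k, 1)] => x; rewrite big_seq1 mul1r. Qed.

Lemma trig_polyD t u : trig_poly t -> trig_poly u ->
  trig_poly (fun x => t x + u x).
Proof. by move=> [s tE] [s' uE]; exists (s ++ s') => x; rewrite big_cat tE uE. Qed.

Lemma trig_polyM t u : trig_poly t -> trig_poly u ->
  trig_poly (fun x => t x * u x).
Proof.
move=> [s tE] [s' uE].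
exists [seq ([tuple tnth p.1 j + tnth q.1 j | j < d], p.2 * q.2) |
  p <- s, q <- s'] => x.
rewrite big_allpairs_dep tE uE big_distrlr /=; apply: eq_bigr => p _.
by apply: eq_bigr => q _; rewrite torus_charM mulrACA.
Qed.

Lemma trig_poly_cst (c : R[i]) : trig_poly (fun=> c).
Proof.
by exists [:: ([tuple 0 | j < d], c)] => x; rewrite big_seq1 torus_char0 mulr1.
Qed.

Lemma trig_polyX t n : trig_poly t -> trig_poly (fun x => t x ^+ n).
Proof.
move=> tt; elim: n => [|n IH].
  by under eq_fun do rewrite expr0; exact: trig_poly_cst.
by under eq_fun do rewrite exprS; exact: trig_polyM.
Qed.

Let unit_tuple (j : 'I_d) (z : int) : d.-tuple int :=
  [tuple if i == j then z else 0 | i < d].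

Let kdot_unit j z (x : T) : kdot (unit_tuple j z) x = z%:~R * tnth x j.
Proof.
rewrite /kdot (bigD1 j)//= tnth_mktuple eqxx big1 ?addr0// => i ij.
by rewrite tnth_mktuple (negPf ij) mul0r.
Qed.

Lemma trig_poly_cos (j : 'I_d) : trig_poly (fun x => (cos (tnth x j))%:C).
Proof.
suff -> : (fun x : T => (cos (tnth x j))%:C) = (fun x => (2^-1)%:C *
    (torus_char (unit_tuple j 1) x + torus_char (unit_tuple j (-1)) x)).
  apply: trig_polyM; first exact: trig_poly_cst.
  by apply: trig_polyD; exact: trig_poly_char.
apply/funext => x; rewrite /torus_char !kdot_unit mul1r mulN1r cosN sinN.
by apply/eqP; rewrite eq_complex /=; apply/andP; split; apply/eqP; field.
Qed.

Lemma trig_poly_sin (j : 'I_d) : trig_poly (fun x => (sin (tnth x j))%:C).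
Proof.
suff -> : (fun x : T => (sin (tnth x j))%:C) = (fun x =>
    (0 +i* - 2^-1) * torus_char (unit_tuple j 1) x +
    (0 +i* 2^-1) * torus_char (unit_tuple j (-1)) x).
  by apply: trig_polyD; apply: trig_polyM; try exact: trig_poly_cst;
    exact: trig_poly_char.
apply/funext => x; rewrite /torus_char !kdot_unit mul1r mulN1r cosN sinN.
by apply/eqP; rewrite eq_complex /=; apply/andP; split; apply/eqP; field.
Qed.

Lemma cmeasurable_torus_char k : cmeasurable (torus_char k).
Proof.
have [mr mi] := @cmeasurable_char R d k; split => //.
under eq_fun do rewrite -[Im _]opprK; exact: measurableT_comp.
Qed.

Lemma trig_poly_cmeasurable t : trig_poly t -> cmeasurable t.
Proof.
move=> [s tE]; have -> : t = fun x => \sum_(p <- s) p.2 * torus_char p.1 x.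
  exact/funext.
elim: s {tE} => [|p s IH].
  by under eq_fun do rewrite big_nil; exact: cmeasurable_cst.
under eq_fun do rewrite big_cons; apply: cmeasurableD => //.
by apply: cmeasurableM; [exact: cmeasurable_cst|exact: cmeasurable_torus_char].
Qed.
End trig_poly.

(** * The L_2 closure of the trigonometric polynomials *)

Section approximable.
Context {R : realType} {d : nat}.
Local Notation T := (d.-tuple (measurableTypeR R)).
Local Notation mu := (torus_measure R d).
Implicit Types (f g t u : T -> R[i]) (k l : d.-tuple int).

(** Kept extended-real, so that a bound [< e%:E] also asserts finiteness. *)
Definition sqdist f g : \bar R := (\int[mu]_x (normc (f x - g x) ^+ 2)%:E)%E.

Definition approximable f : Prop := cmeasurable f /\
  forall e : R, 0 < e -> exists2 t, trig_poly t & (sqdist f t < e%:E)%E.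

Lemma cmeasurableB f g : cmeasurable f -> cmeasurable g ->
  cmeasurable (fun x => f x - g x).
Proof.
move=> mf mg; apply: cmeasurableD => //.
by under eq_fun do rewrite -mulN1r; apply: cmeasurableM => //;
  exact: cmeasurable_cst.
Qed.

(** Pointwise [|a + b|^2 <= 2|a|^2 + 2|b|^2] replaces the triangle inequality of the norm; two
    errors below [e/4] then combine to one below [e]. *)
Lemma sqdistD f f' g g' : cmeasurable f -> cmeasurable f' ->
    cmeasurable g -> cmeasurable g' ->
  (sqdist (fun x => f x + f' x)%R (fun x => g x + g' x)%R <=
   2%:E * sqdist f g + 2%:E * sqdist f' g')%E.
Proof.
move=> mf mf' mg mg'; rewrite /sqdist.
have mB := cmeasurableB mf mg; have mB' := cmeasurableB mf' mg'.
rewrite -!ge0_integralZl//; try (by move=> x _; rewrite lee_fin sqr_ge0);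
  try exact: measurable_normc_sqr.
have mZ h : cmeasurable h ->
    measurable_fun [set: T] (fun x => (2%:E * (normc (h x) ^+ 2)%:E)%E).
  by move=> mh; apply: measurable_funeM; exact: measurable_normc_sqr.
rewrite -ge0_integralD//; try exact: mZ;
  try (by move=> x _; rewrite -EFinM lee_fin mulr_ge0 ?sqr_ge0).
apply: ge0_le_integral => //.
- by move=> x _; rewrite lee_fin sqr_ge0.
- by apply: measurable_normc_sqr; apply: cmeasurableB; exact: cmeasurableD.
- by apply: emeasurable_funD; exact: mZ.
- move=> x _; rewrite -!EFinM -EFinD lee_fin.
  by rewrite opprD addrACA normcD_sqr.
Qed.

Lemma approximableD f g : approximable f -> approximable g ->
  approximable (fun x => f x + g x).
Proof.
move=> [mf af] [mg ag]; split; first exact: cmeasurableD.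
move=> e e0; have e4 : 0 < e / 4 by rewrite divr_gt0.
have [t tt ft] := af _ e4; have [u tu gu] := ag _ e4.
exists (fun x => t x + u x); first exact: trig_polyD.
apply: (le_lt_trans (sqdistD mf mg (trig_poly_cmeasurable tt)
  (trig_poly_cmeasurable tu))).
have -> : e%:E = (2%:E * (e / 4)%:E + 2%:E * (e / 4)%:E)%E.
  by rewrite -!EFinM -EFinD; congr _%:E; field.
by apply: lteD; rewrite lte_pmul2l// lte_fin.
Qed.

Lemma approximableZ (c : R[i]) f : approximable f ->
  approximable (fun x => c * f x).
Proof.
move=> [mf af]; split; first exact: cmeasurableM (cmeasurable_cst c) mf.
(* The added 1 keeps the divisor positive when [c = 0]. *)
move=> e e0; have n0 : 0 < normc c ^+ 2 + 1 by rewrite ltr_wpDl ?sqr_ge0.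
have [t tt ft] := af _ (divr_gt0 e0 n0).
exists (fun x => c * t x); first exact: trig_polyM (trig_poly_cst c) tt.
rewrite /sqdist; under eq_integral do rewrite -mulrBr normcM exprMn EFinM.
rewrite ge0_integralZl ?lee_fin ?sqr_ge0//; last 2 first.
- by apply: measurable_normc_sqr; apply: cmeasurableB => //;
    exact: trig_poly_cmeasurable.
- by move=> x _; rewrite lee_fin sqr_ge0.
apply: (@le_lt_trans _ _ ((normc c ^+ 2 + 1)%:E * sqdist f t)%E).
  apply: lee_wpmul2r; last by rewrite lee_fin lerDl.
  by apply: integral_ge0 => x _; rewrite lee_fin sqr_ge0.
by rewrite muleC -lte_pdivlMr// -EFinM.
Qed.

Lemma approximable_lim f : cmeasurable f ->
    (forall e : R, 0 < e -> exists2 g, approximable g & (sqdist f g < e%:E)%E) ->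
  approximable f.
Proof.
move=> mf af; split=> // e e0; have e4 : 0 < e / 4 by rewrite divr_gt0.
have [g [mg ag] fg] := af _ e4; have [t tt gt] := ag _ e4.
exists t => //; have mt := trig_poly_cmeasurable tt.
(* Writing [f - t] as [(f + g) - (g + t)] brings the triangle inequality through [g] into the form
   of [sqdistD]. *)
have -> : sqdist f t = sqdist (fun x => f x + g x) (fun x => g x + t x).
  by apply: eq_integral => x _; congr ((normc _ ^+ 2)%:E); ring.
apply: (le_lt_trans (sqdistD mf mg mg mt)).
have -> : e%:E = (2%:E * (e / 4)%:E + 2%:E * (e / 4)%:E)%E.
  by rewrite -!EFinM -EFinD; congr _%:E; field.
by apply: lteD; rewrite lte_pmul2l// lte_fin.
Qed.

Lemma trig_poly_approximable t : trig_poly t -> approximable t.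
Proof.
move=> tt; split; first exact: trig_poly_cmeasurable.
move=> e e0; exists t => //; rewrite /sqdist.
under eq_integral do rewrite subrr normc0 expr0n.
by rewrite integral0 lte_fin.
Qed.

Lemma cmeasurable_real (f : T -> R) : measurable_fun setT f ->
  cmeasurable (fun x => (f x)%:C).
Proof. by split => //=; exact: measurable_cst. Qed.

(** The squared errors tend to 0 almost everywhere and stay below the integrable [g], so by
    dominated convergence their integrals tend to 0. All later passages to a limit go through this
    lemma. *)
Lemma approximable_dominated (f g : T -> R) (u : nat -> T -> R) :
  measurable_fun setT f -> mu.-integrable setT (EFin \o g) ->
  (forall n, approximable (fun x => (u n x)%:C)) ->
  {ae mu, forall x, u ^~ x @ \oo --> f x} ->
  (forall n x, (f x - u n x) ^+ 2 <= g x) ->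
  approximable (fun x => (f x)%:C).
Proof.
move=> mf ig au uf fug; apply: approximable_lim; first exact: cmeasurable_real.
have mu_ n : measurable_fun [set: T] (u n) by have [[]] := au n.
pose F n x := ((f x - u n x) ^+ 2)%:E.
have mF n : measurable_fun [set: T] (F n).
  by apply/measurable_EFinP; apply: measurable_funX; exact: measurable_funB.
have F0 : {ae mu, forall x, [set: T] x -> F ^~ x @ \oo --> 0%E}.
  apply: filterS uf => x ux _.
  have fu : (fun n => f x - u n x) @ \oo --> f x - f x.
    by apply: cvgB => //; exact: cvg_cst.
  have := cvgM fu fu; rewrite subrr mulr0 => /(_ _) ff; apply/fine_cvgP; split.
    by near=> n.
  move: ff; apply: cvg_trans; apply: near_eq_cvg; near=> n.
  by rewrite /F /= expr2.
have Fg : {ae mu, forall x n, [set: T] x -> (`|F n x| <= (EFin \o g) x)%E}.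
  by apply: aeW => x n _; rewrite /F gee0_abs ?lee_fin ?sqr_ge0.
have [_ _] := dominated_convergence measurableT mF (measurable_cst _) F0 ig Fg.
rewrite integral0 => F00.
move=> e e0.
have /F00 [N _ /(_ N (leqnn N))/= FN] : nbhs (0%E : \bar R) [set y | (y < e%:E)%E].
  by apply: open_nbhs_nbhs; split; [exact: open_ereal_lt_ereal|rewrite /= lte_fin].
exists (fun x => (u N x)%:C) => //.
rewrite /sqdist; apply: le_lt_trans FN; rewrite le_eqVlt; apply/orP; left; apply/eqP.
by apply: eq_integral => x _; rewrite normc_sqr /= oppr0 addr0 expr0n /= addr0.
Unshelve. all: by end_near.
Qed.

End approximable.

(** * Polynomials converging to a step function on [0, 1] *)

Section polynomial_step.
Context {R : realType}.
Implicit Types y z : R.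

Lemma bernoulli_ge z n : z <= 1 -> 1 - n%:R * z <= (1 - z) ^+ n.
Proof.
move=> z1; elim: n => [|n IH]; first by rewrite mul0r subr0 expr0.
have z0 : 0 <= 1 - z by rewrite subr_ge0.
rewrite exprS; apply: le_trans (ler_wpM2l z0 IH).
by rewrite -natr1 -subr_ge0; have := mulr_ge0 (ler0n R n) (sqr_ge0 z); nra.
Qed.

(** Bernoulli's inequality at [-z] gives [1 + n z <= (1 + z)^n]; multiplying by [(1 - z)^n] leaves
    [(1 - z^2)^n <= 1]. *)
Lemma bernoulli_le z n : 0 <= z <= 1 -> (1 - z) ^+ n * (1 + n%:R * z) <= 1.
Proof.
move=> /andP[z0 z1]; have zz0 : 0 <= 1 - z by rewrite subr_ge0.
have : 1 + n%:R * z <= (1 + z) ^+ n.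
  have := @bernoulli_ge (- z) n; rewrite mulrN !opprK; apply.
  by rewrite (le_trans _ ler01)// oppr_le0.
move=> /(ler_wpM2l (exprn_ge0 n zz0))/le_trans; apply.
rewrite -exprMn exprn_ile1//.
  by rewrite mulr_ge0// addr_ge0.
by have := sqr_ge0 z; nra.
Qed.

(* Tends to the indicator of [y < 1/2], except at [y = 1/2]. *)
Definition poly_step n y : R := (1 - y ^+ n) ^+ (2 ^ n).

Lemma poly_step01 n y : 0 <= y <= 1 -> 0 <= poly_step n y <= 1.
Proof.
move=> /andP[y0 y1]; have yn0 := exprn_ge0 n y0; have yn1 := exprn_ile1 n y0 y1.
by rewrite exprn_ge0 ?exprn_ile1 ?subr_ge0// lerBlDr lerDl.
Qed.

(** Bernoulli's inequality with exponent [2^n] gives the lower bound [1 - 2^n y^n = 1 - (2y)^n], and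
    [2y < 1]. *)
Lemma poly_step_cvg1 y : 0 <= y < 2^-1 -> poly_step ^~ y @ \oo --> (1 : R).
Proof.
move=> /andP[y0 y1].
have y01 : 0 <= y <= 1 by rewrite y0; lra.
have z1 : `|2 * y| < 1 by rewrite ger0_norm; lra.
apply: (@squeeze_cvgr _ _ _ _ (fun n => 1 - (2 * y) ^+ n) (fun=> 1)).
- near=> n; have /andP[_ ->] := poly_step01 n y01; rewrite andbT.
  rewrite exprMn -natrX; apply: bernoulli_ge.
  by apply: exprn_ile1 => //; lra.
- rewrite -[X in _ --> X](subr0 (1 : R)); apply: cvgB; first exact: cvg_cst.
  exact: cvg_expr.
- exact: cvg_cst.
Unshelve. all: by end_near.
Qed.

(** By [bernoulli_le] the value times [1 + (2y)^n] is at most 1, hence it is at most [(2y)^-n], and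
    [2y > 1]. *)
Lemma poly_step_cvg0 y : 2^-1 < y <= 1 -> poly_step ^~ y @ \oo --> (0 : R).
Proof.
move=> /andP[y0 y1].
have y01 : 0 <= y <= 1 by rewrite y1 andbT; lra.
have z1 : `|(2 * y)^-1| < 1.
  by rewrite ger0_norm ?invr_ge0 ?invf_lt1; lra.
apply: (@squeeze_cvgr _ _ _ _ (fun=> 0) (fun n => (2 * y)^-1 ^+ n)).
- near=> n; have /andP[-> _] /= := poly_step01 n y01.
  have yn : 0 < (2 * y) ^+ n by apply: exprn_gt0; lra.
  rewrite exprVn -div1r ler_pdivlMr//.
  have yn01 : 0 <= y ^+ n <= 1.
    by apply/andP; split; [apply: exprn_ge0|apply: exprn_ile1]; lra.
  apply: le_trans (bernoulli_le (2 ^ n) yn01).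
  have /andP[s0 _] := poly_step01 n y01.
  by apply: ler_wpM2l => //; rewrite exprMn natrX lerDr.
- exact: cvg_cst.
- exact: cvg_expr.
Unshelve. all: by end_near.
Qed.
End polynomial_step.

(** * Null sets of the torus determined by one coordinate *)

Section null_coordinate.
Context {R : realType}.
Local Notation T := (measurableTypeR R).

Lemma circle_measure_finite (B : set T) : measurable B ->
  finite_set (B `&` `[0, 2 * pi]) -> @circle_measure R B = 0%E.
Proof. by move=> mB fB; apply: countable_lebesgue_measure0; exact: finite_set_countable. Qed.

(** Induction on the dimension: the preimage under consing is a rectangle, [B] times everything for
    the first coordinate, and everything times a null set otherwise. *)
Lemma torus_measure_coord0 (d : nat) (j : 'I_d) (B : set T) : measurable B ->
  @circle_measure R B = 0%E ->
  torus_measure R d [set x : d.-tuple T | B (tnth x j)] = 0%E.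
Proof.
move=> mB B0; elim: d j => [[]//|d IH] j.
pose h (x : T * d.-tuple T) : d.+1.-tuple T := [the d.+1.-tuple T of x.1 :: x.2].
(* In dimension [d.+1] the torus measure is by definition the pushforward of this product along
   [h]. *)
change ((@circle_measure R \x torus_measure R d)%E
  (h @^-1` [set x | B (tnth x j)]) = 0%E).
case: (unliftP ord0 j) => [i ->|->].
  have -> : h @^-1` [set x | B (tnth x (lift ord0 i))] =
      setT `*` [set x : d.-tuple T | B (tnth x i)].
    by apply/seteqP; split=> [[a x]|[a x]] /=; rewrite /h /= tnthS// => -[].
  rewrite product_measure1E//.
    by apply: (etrans (congr1 (mule _) (IH i))); rewrite mule0.
  rewrite -[X in measurable X]setTI; exact: (measurable_tnth i measurableT mB).
have -> : h @^-1` [set x | B (tnth x ord0)] = B `*` setT.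
  by apply/seteqP; split=> [[a x]|[a x]] /=; rewrite /h /= tnth0// => -[].
rewrite product_measure1E//.
by apply: (etrans (congr1 (fun z => (z * _)%E) B0)); rewrite mul0e.
Qed.
End null_coordinate.

(** * Approximation of indicators, simple functions and square-integrable functions *)

Section density.
Import HBNNSimple.
Context {R : realType} {d : nat}.
Local Notation T := (d.-tuple (measurableTypeR R)).
Local Notation mu := (torus_measure R d).

(** Almost everywhere convergence with values in [0, 1] is asked for, rather than L_2 approximation,
    because it passes to products and hence to intersections. *)
Definition trig_limit_set (A : set T) : Prop := measurable A /\
  exists t : nat -> T -> R, [/\ forall n, trig_poly (fun x => (t n x)%:C),
    forall n x, 0 <= t n x <= 1 &
    {ae mu, forall x, t ^~ x @ \oo --> (\1_A x : R)}].

Lemma trig_limit_set_approximable A : trig_limit_set A ->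
  approximable (fun x : T => (\1_A x)%:C).
Proof.
move=> [mA [t [tt t01 tA]]].
apply: (@approximable_dominated _ _ _ (cst 1) t) => //.
- exact: finite_measure_integrable_cst.
- by move=> n; exact: trig_poly_approximable.
- move=> n x; have /andP[t0 t1] := t01 n x.
  by rewrite indicE /=; case: (x \in A); rewrite ?(mulr1n, mulr0n); nra.
Qed.

Lemma trig_limit_setI : setI_closed trig_limit_set.
Proof.
move=> A B [mA [t [tt t01 tA]]] [mB [u [uu u01 uB]]].
split; first exact: measurableI.
exists (fun n x => t n x * u n x); split.
- move=> n; have -> : (fun x : T => (t n x * u n x)%:C) =
      (fun x => (t n x)%:C * (u n x)%:C) by apply/funext => x; rewrite rmorphM.
  exact: trig_polyM.
- move=> n x; have /andP[t0 t1] := t01 n x; have /andP[u0 u1] := u01 n x.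
  by rewrite mulr_ge0// mulr_ile1.
- apply: filterS2 tA uB => x tx ux; rewrite indicI.
  by have := cvgM tx ux; apply.
Qed.

(* On the open cube [cos (b/2) - cos (x_j - b/2)], which equals
   [2 sin (x_j/2) sin ((x_j - b)/2)], has the sign of [x_j - b]. *)
Lemma trig_limit_set_halfspace (j : 'I_d) (a : R) :
  trig_limit_set [set x : T | a < tnth x j].
Proof.
split.
  have -> : [set x : T | a < tnth x j] =
      setT `&` (fun x : T => tnth x j) @^-1` `]a, +oo[.
    by apply/seteqP; split=> x /=; rewrite in_itv /= andbT// => -[].
  by apply: measurable_tnth => //; exact: measurable_itv.
(* Clamping [a] to [0, 2 pi] does not change the half-space on the open cube, and keeps all
   half-angles where the sign of the sine is known. *)
pose b := Num.max 0 (Num.min a (2 * pi)).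
have p0 := @pi_gt0 R.
have /andP[b0 b2] : 0 <= b <= 2 * pi.
  by rewrite /b le_max lexx ge_max ge_min lexx orbT andbT; lra.
(* The difference of cosines lies in [-2, 2], so [y] lies in [0, 1]; on the open cube [y < 1/2]
   exactly when [x_j > b], which is where [poly_step] tends to 1. *)
pose y (x : T) := 2^-1 - 4^-1 * (cos (b / 2) - cos (tnth x j - b / 2)).
have y01 x : 0 <= y x <= 1.
  have := cos_max (b / 2); have := cos_max (tnth x j - b / 2).
  by rewrite !ler_norml /y => /andP[? ?] /andP[? ?]; lra.
exists (fun n x => poly_step n (y x)); split.
- have ty : trig_poly (fun x : T => (y x)%:C).
    have -> : (fun x : T => (y x)%:C) = (fun x =>
        (2^-1 - 4^-1 * cos (b / 2))%:C +
        ((4^-1 * cos (b / 2))%:C * (cos (tnth x j))%:C +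
         (4^-1 * sin (b / 2))%:C * (sin (tnth x j))%:C)).
      apply/funext => x; rewrite -!rmorphM -!rmorphD /y cosB.
      by congr (_%:C); ring.
    apply: trig_polyD; first exact: trig_poly_cst.
    by apply: trig_polyD; apply: trig_polyM; try exact: trig_poly_cst;
      [exact: trig_poly_cos|exact: trig_poly_sin].
  move=> n.
  have -> : (fun x : T => (poly_step n (y x))%:C) =
      (fun x => (1 + (-1) * (y x)%:C ^+ n) ^+ (2 ^ n)).
    by apply/funext => x; rewrite mulN1r /poly_step rmorphXn rmorphB rmorph1 rmorphXn.
  apply: trig_polyX; apply: trig_polyD; first exact: trig_poly_cst.
  by apply: trig_polyM; [exact: trig_poly_cst|exact: trig_polyX].
- by move=> n x; exact: poly_step01.
(* Convergence can fail only where [x_j] leaves the open interval or equals [b]; within [0, 2 pi]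
   these are at most three points. *)
pose B : set (measurableTypeR R) := ~` `]0, 2 * pi[ `|` [set b].
have mB : measurable B by apply: measurableU => //; apply: measurableC.
exists [set x : T | B (tnth x j)]; split.
- have := measurable_tnth j measurableT mB; rewrite setTI; exact.
- apply: torus_measure_coord0 => //; apply: circle_measure_finite => //.
  apply: (@sub_finite_set _ _ [set 0; 2 * pi; b]); last first.
    by rewrite !finite_setU; split; [split|]; exact: finite_set1.
  move=> z [[/= zo|->]]; last by right.
  rewrite /= in_itv /= => /andP[z0 z2]; left.
  have [->|zn0] := eqVneq z 0; first by left.
  have [->|zn2] := eqVneq z (2 * pi); first by right.
  by exfalso; apply: zo; rewrite in_itv /= !lt_neqAle z0 z2 eq_sym zn0 zn2.
- move=> x /= nx; apply: contrapT => nB; apply: nx.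
  have {nB}[xo xb] : (0 < tnth x j < 2 * pi) /\ tnth x j != b.
    split; last by apply/eqP => xb; apply: nB; right.
    by apply: contrapT => xo; apply: nB; left; rewrite /= in_itv.
  move: xo => /andP[x0 x2].
  set z := tnth x j in x0 x2 xb *.
  have usin : cos (b / 2) - cos (z - b / 2) = 2 * (sin (z / 2) * sin ((z - b) / 2)).
    have -> : b / 2 = z / 2 - (z - b) / 2 by field.
    have -> : z - (z / 2 - (z - b) / 2) = z / 2 + (z - b) / 2 by field.
    by rewrite cosB cosD; ring.
  have sz : 0 < sin (z / 2) by apply: sin_gt0_pi; apply/andP; split; lra.
  have ab : (a < z) = (b < z).
    by rewrite /b gt_max gt_min x0 (ltNge (2 * pi)) (ltW x2) orbF.
  rewrite indicE; case: (ltgtP b z) xb => // bz _.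
  + rewrite mem_set /= ?ab//.
    apply: poly_step_cvg1; have /andP[-> _] := y01 x; rewrite /= /y -/z usin.
    have : 0 < sin ((z - b) / 2) by apply: sin_gt0_pi; apply/andP; split; lra.
    by nra.
  + rewrite memNset /=; last first.
      by rewrite ab => /(lt_trans bz); rewrite ltxx.
    apply: poly_step_cvg0; have /andP[_ ->] := y01 x; rewrite andbT /= /y -/z usin.
    have : 0 < sin ((b - z) / 2) by apply: sin_gt0_pi; apply/andP; split; lra.
    rewrite (_ : (z - b) / 2 = - ((b - z) / 2)); last by field.
    by rewrite sinN; nra.
Qed.

(** Open rays generate the Borel sets of the line, and preimages under the coordinates generate the
    sigma-algebra of tuples, so the half-spaces suffice. *)
Lemma measurable_trig_limit_set : @measurable _ T = <<s trig_limit_set >>.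
Proof.
apply/seteqP; split; last first.
  apply: smallest_sub; first exact: sigma_algebra_measurable.
  by move=> A [].
apply: smallest_sub; first exact: smallest_sigma_algebra.
suff H (j : 'I_d) : preimage_set_system [set: T] (fun x => tnth x j) measurable
    `<=` <<s trig_limit_set >>.
  by elim/big_ind: _ => // A B HA HB C [/HA|/HB].
have -> : @measurable _ (measurableTypeR R) = (@RGenOInfty.G R).-sigma.-measurable.
  by rewrite -RGenOInfty.measurableE.
rewrite -g_sigma_preimageE; apply: smallest_sub; first exact: smallest_sigma_algebra.
move=> _ [_ [a ->] <-]; apply: sub_sigma_algebra; rewrite setTI.
have -> : (fun x : T => tnth x j) @^-1` `]a, +oo[ = [set x : T | a < tnth x j].
  by apply/seteqP; split=> x /=; rewrite in_itv /= andbT.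
exact: trig_limit_set_halfspace.
Qed.

(** Pi-lambda theorem: the sets with approximable indicator are stable under complement, through
    [1 - 1_S], and under countable disjoint union, through dominated convergence of the partial
    sums. *)
Lemma approximable_indic (A : set T) : measurable A ->
  approximable (fun x : T => (\1_A x)%:C).
Proof.
move=> mA; rewrite measurable_trig_limit_set in mA.
have a1 : approximable (fun _ : T => 1).
  by apply: trig_poly_approximable; exact: trig_poly_cst.
move: A mA; apply: (dynkin_induction measurable_trig_limit_set) => /=.
- exact: trig_limit_setI.
- by under eq_fun do rewrite indicT.
- by move=> A; exact: trig_limit_set_approximable.
- move=> S mS aS.
  have -> : (fun x : T => (\1_(~` S) x)%:C) = (fun x => 1 + (-1) * (\1_S x)%:C :> R[i]).
    apply/funext => x; rewrite !indicE in_setC; case: (x \in S) => /=.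
      by rewrite rmorph1 mulr1 subrr rmorph0.
    by rewrite rmorph0 mulr0 addr0 rmorph1.
  by apply: approximableD => //; exact: approximableZ.
move=> F mF tF aF.
pose u n (x : T) : R := \sum_(k < n) \1_(F k) x.
(* By disjointness a point of [F m] lies in no other member, so the partial sum jumps once from 0 to
   1; this gives both the limit and the bound 1. *)
have uE m x n : F m x -> u n x = (m < n)%:R.
  move=> Fmx; rewrite /u; elim: n => [|n IH]; first by rewrite big_ord0.
  rewrite big_ord_recr /= IH indicE.
  have -> : (x \in F n) = (n == m).
    apply/idP/eqP => [/set_mem Fnx|->]; last exact: mem_set.
    by apply: (tF n m) => //; exists x.
  by rewrite -natrD; congr (_%:R); rewrite ltnS (leq_eqVlt m) [n == m]eq_sym; case: ltngtP.
have u0 x n : ~ (\bigcup_k F k) x -> u n x = 0.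
  move=> nF; rewrite /u big1// => k _; rewrite indicE memNset// => Fkx.
  by apply: nF; exists k.
apply: (@approximable_dominated _ _ _ (cst 1) u) => //.
- apply: measurable_indic; exact: bigcup_measurable.
- exact: finite_measure_integrable_cst.
- elim=> [|n IH].
    have -> : (fun x : T => (u 0%N x)%:C) = (fun _ : T => 0 * 1).
      by apply/funext => x; rewrite /u big_ord0 mul0r.
    exact: approximableZ.
  have -> : (fun x : T => (u n.+1 x)%:C) = (fun x => (u n x)%:C + (\1_(F n) x)%:C).
    by apply/funext => x; rewrite /u big_ord_recr rmorphD.
  exact: approximableD.
- apply: aeW => x; have [|nx] := pselect ((\bigcup_k F k) x).
    move=> Fx; have [m _ Fmx] := Fx; rewrite indicE mem_set//.
    apply: cvg_near_cst; exists m.+1 => // n /= mn.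
    by rewrite (uE m)// mn.
  rewrite indicE memNset//; apply: cvg_near_cst; apply: nearW => n.
  by rewrite u0.
- move=> n x; rewrite indicE /=; have [Fx|nx] := pselect ((\bigcup_k F k) x).
    have [m _ Fmx] := Fx; rewrite mem_set// (uE m)//.
    by case: (m < n)%N; rewrite ?(mulr1n, mulr0n); nra.
  by rewrite memNset// u0// mulr0n subrr expr0n ler01.
Qed.

Lemma approximable_sum (I : Type) (s : seq I) (F : I -> T -> R[i]) :
  (forall i, approximable (F i)) -> approximable (fun x => \sum_(i <- s) F i x).
Proof.
move=> aF; elim: s => [|i s IH].
  under eq_fun do rewrite big_nil.
  by apply: trig_poly_approximable; exact: trig_poly_cst.
by under eq_fun do rewrite big_cons; exact: approximableD.
Qed.

(** Simple functions increase to [f], with squared error at most the integrable [f^2]. *)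
Lemma approximable_ge0 (f : T -> R) : measurable_fun setT f ->
  (forall x, 0 <= f x) -> mu.-integrable setT (fun x => (f x ^+ 2)%:E) ->
  approximable (fun x => (f x)%:C).
Proof.
move=> mf f0 if2.
have mf' : measurable_fun setT (EFin \o f) by exact/measurable_EFinP.
have f0' x : setT x -> (0 <= (EFin \o f) x)%E by move=> _; rewrite lee_fin.
pose u n : T -> R := nnsfun_approx measurableT mf' n.
apply: (@approximable_dominated _ _ _ (fun x => f x ^+ 2) u) => //.
- move=> n; rewrite /u.
  under eq_fun do rewrite fimfunEord rmorph_sum /=.
  apply: approximable_sum => i.
  under eq_fun do rewrite rmorphM.
  apply: approximableZ; apply: approximable_indic.
  by [].
- apply: aeW => x; have /fine_cvgP[_] :=
    cvg_nnsfun_approx measurableT mf' f0' Logic.I (x := x).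
  exact.
- move=> n x; rewrite /u.
  have u0 : 0 <= nnsfun_approx measurableT mf' n x by exact: fun_ge0.
  have uf : nnsfun_approx measurableT mf' n x <= f x.
    by rewrite -lee_fin nnsfun_approxE; exact: (le_approx _ f0').
  by nra.
Qed.

(** Reduction to nonnegative functions: positive and negative parts of the real and imaginary parts,
    whose squares are all bounded by [|f|^2]. *)
Lemma approximable_square_integrable (f : T -> R[i]) :
  square_integrable f -> approximable f.
Proof.
move=> [[mr mi] fi].
have sq (g : T -> R) : measurable_fun setT g ->
    (forall x, g x ^+ 2 <= normc (f x) ^+ 2) ->
    mu.-integrable setT (fun x => (g x ^+ 2)%:E).
  move=> mg gf; apply/integrableP; split.
    by apply/measurable_EFinP; exact: measurable_funX.
  apply: le_lt_trans fi; apply: ge0_le_integral => //.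
  - by apply: measurableT_comp => //; apply/measurable_EFinP; exact: measurable_funX.
  - exact: measurable_normc_sqr.
  - by move=> x _; rewrite gee0_abs lee_fin ?sqr_ge0.
have real (g : T -> R) : measurable_fun setT g ->
    (forall x, g x ^+ 2 <= normc (f x) ^+ 2) -> approximable (fun x => (g x)%:C).
  move=> mg gf.
  have -> : (fun x => (g x)%:C) = (fun x => (g^\+ x)%:C + (-1) * (g^\- x)%:C).
    by apply/funext => x; rewrite mulN1r -rmorphB; congr (_%:C);
      rewrite -[in LHS](funrposBneg g).
  have mp := measurable_funrpos mg; have mn := measurable_funrneg mg.
  apply: approximableD; last apply: approximableZ.
  - apply: approximable_ge0 => //.
    apply: sq => // x; apply: le_trans (gf x).
    by rewrite /funrpos; case: (leP (g x) 0) => _; rewrite ?expr0n ?sqr_ge0.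
  - apply: approximable_ge0 => //.
    apply: sq => // x; apply: le_trans (gf x).
    by rewrite /funrneg; case: (leP (- g x) 0) => _; rewrite ?expr0n ?sqr_ge0 ?sqrrN.
have -> : f = (fun x => (Re (f x))%:C + 'i * (Im (f x))%:C).
  by apply/funext => x; exact: complexE.
apply: approximableD; last apply: approximableZ.
- by apply: real => // x; rewrite normc_sqr lerDl sqr_ge0.
- by apply: real => // x; rewrite normc_sqr lerDr sqr_ge0.
Qed.

End density.

(** * Orthonormality of the characters *)

Section circle_integral.
Context {R : realType}.
Local Notation T := (measurableTypeR R).
Local Notation circle := (@circle_measure R).

Lemma bounded_integrable (dT : measure_display) (X : measurableType dT)
    (m : {finite_measure set X -> \bar R}) (f : X -> R) (c : R) :
  measurable_fun setT f -> (forall x, `|f x| <= c) ->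
  m.-integrable setT (EFin \o f).
Proof.
move=> mf fc; apply: (@le_integrable _ _ _ m _ measurableT _ (EFin \o cst c)).
- exact/measurable_EFinP.
- by move=> x _ /=; rewrite lee_fin (le_trans (fc x))// ler_norm.
- exact: finite_measure_integrable_cst.
Qed.

Lemma sin_2pi_int (z : int) : sin (z%:~R * (2 * pi)) = 0 :> R.
Proof.
have H n : sin (n%:R * (2 * pi)) = 0 :> R.
  rewrite (_ : n%:R * _ = 0 + pi *+ 2 *+ n); last by rewrite add0r !mulr_natl.
  by rewrite (periodicn (@sinD2pi R)) sin0.
by case: z => n; rewrite ?NegzE ?intrN ?mulNr ?sinN ?H ?oppr0//; exact: H.
Qed.

Lemma cos_2pi_int (z : int) : cos (z%:~R * (2 * pi)) = 1 :> R.
Proof.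
have H n : cos (n%:R * (2 * pi)) = 1 :> R.
  rewrite (_ : n%:R * _ = 0 + pi *+ 2 *+ n); last by rewrite add0r !mulr_natl.
  by rewrite (periodicn (@cosD2pi R)) cos0.
by case: z => n; rewrite ?NegzE ?intrN ?mulNr ?cosN ?H//; exact: H.
Qed.

(** The circle measure gives mass 0 to the complement of [0, 2 pi] and agrees with Lebesgue measure
    on its subsets, which reduces the claim to the fundamental theorem of calculus. The bound [c]
    supplies integrability. *)
Lemma circle_integral_derivative (f F : R -> R) (c : R) :
  (forall x, is_derive x (1 : R) F (f x)) -> continuous f ->
  (forall x, `|f x| <= c) ->
  (\int[circle]_x (f x)%:E = (F (2 * pi) - F 0)%:E)%E.
Proof.
move=> dF cf fc.
have p0 : 0 < 2 * pi :> R by rewrite mulr_gt0// pi_gt0.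
have mf : measurable_fun [set: T] f by exact: continuous_measurable_fun.
have mI : measurable (`[0, 2 * pi] : set T) by exact: measurable_itv.
have cF : continuous F.
  by move=> x; apply: differentiable_continuous; apply/derivable1_diffP; have [] := dF x.
have IN : circle (~` `[0, 2 * pi]) = 0%E.
  change (lebesgue_measure (~` (`[0, 2 * pi] : set T) `&` `[0, 2 * pi]) = 0%E).
  by rewrite setICl measure0.
have iF := @bounded_integrable _ T circle f c mf fc.
have := negligible_integral (measurableC mI) measurableT iF IN.
rewrite setTD setCK => ->.
rewrite (eq_measure_integral lebesgue_measure); last first.
  move=> A mA AI.
  change (lebesgue_measure (A `&` `[0, 2 * pi]) = lebesgue_measure A).
  by rewrite (setIidl AI).
rewrite (@continuous_FTC2 _ f F 0 (2 * pi))//.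
- exact: continuous_subspaceT.
- split.
  + by move=> x _; have [] := dF x.
  + exact: cvg_at_right_filter (cF 0).
  + exact: cvg_at_left_filter (cF _).
- by move=> x _; rewrite derive1E; have [] := dF x.
Qed.

Lemma circle_integral_cos (z : int) :
  (\int[circle]_x (cos (z%:~R * x))%:E = (if z == 0 then 2 * pi else 0)%:E)%E.
Proof.
have cc : continuous (fun x : R => cos (z%:~R * x)).
  move=> x; apply: continuous_comp; last exact: continuous_cos.
  exact: mulrl_continuous.
have bc x : `|cos (z%:~R * x)| <= 1 :> R by exact: cos_max.
have [z0|z0] := eqVneq z 0.
  have dF x : is_derive x (1 : R) id (cos (z%:~R * x)).
    by rewrite z0 mul0r cos0; exact: is_derive_id.
  by rewrite (@circle_integral_derivative _ _ 1 dF cc bc) subr0.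
have z0R : z%:~R != 0 :> R by rewrite intr_eq0.
have dF x : is_derive x (1 : R) (fun x => z%:~R^-1 * sin (z%:~R * x)) (cos (z%:~R * x)).
  by apply: is_derive_eq; rewrite /GRing.scale /=; field.
by rewrite (@circle_integral_derivative _ _ 1 dF cc bc) sin_2pi_int !mulr0 sin0 mulr0 subrr.
Qed.

Lemma circle_integral_sin (z : int) :
  (\int[circle]_x (sin (z%:~R * x))%:E = 0)%E.
Proof.
have [->|z0] := eqVneq z 0.
  by under eq_integral do rewrite mul0r sin0; rewrite integral0.
have cs : continuous (fun x : R => sin (z%:~R * x)).
  move=> x; apply: continuous_comp; last exact: continuous_sin.
  exact: mulrl_continuous.
have bs x : `|sin (z%:~R * x)| <= 1 :> R by exact: sin_max.
have z0R : z%:~R != 0 :> R by rewrite intr_eq0.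
have dF x : is_derive x (1 : R) (fun x => - z%:~R^-1 * cos (z%:~R * x)) (sin (z%:~R * x)).
  by apply: is_derive_eq; rewrite /GRing.scale /=; field.
by rewrite (@circle_integral_derivative _ _ 1 dF cs bs) cos_2pi_int mulr0 cos0 subrr.
Qed.

End circle_integral.

(** * Fubini's theorem for a product of bounded functions of separate variables *)

Section product_integral.
Context d1 d2 (T1 : measurableType d1) (T2 : measurableType d2) (R : realType).
Variables (m1 : {finite_measure set T1 -> \bar R}).
Variables (m2 : {finite_measure set T2 -> \bar R}).
Variables (a : T1 -> R) (b : T2 -> R).
Hypotheses (ma : measurable_fun setT a) (mb : measurable_fun setT b).
Hypotheses (a1 : forall x, `|a x| <= 1) (b1 : forall x, `|b x| <= 1).

Let mf : measurable_fun setT (fun z : T1 * T2 => (a z.1 * b z.2)%:E).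
Proof.
apply/measurable_EFinP; apply: measurable_funM.
  exact: measurableT_comp ma measurable_fst.
exact: measurableT_comp mb measurable_snd.
Qed.

Lemma integrable_prod_mul :
  (m1 \x m2)%E.-integrable setT (fun z => (a z.1 * b z.2)%:E).
Proof.
apply/integrable12ltyP => //=.
apply: (@le_lt_trans _ _ (\int[m1]_x cst (\int[m2]_y cst 1%:E y) x)%E); last first.
  rewrite integral_cst// integral_cst// ?mul1e.
  by rewrite lte_mul_pinfty ?fin_num_measure// ltey_eq fin_num_measure.
have mab : measurable_fun setT (fun z : T1 * T2 => (`|(a z.1 * b z.2)%:E|)%E).
  exact: measurableT_comp.
apply: ge0_le_integral => //.
- by move=> x _; exact: integral_ge0.
- exact: (measurable_fun_fubini_tonelli_F _ mab).
- move=> x _; apply: ge0_le_integral => //.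
  + apply/measurable_EFinP; apply: measurableT_comp => //.
    exact: (measurable_funM (measurable_cst _) mb).
  + by move=> y _; rewrite lee_fin normrM mulr_ile1.
Qed.

Lemma integral_prod_mul : (\int[(m1 \x m2)%E]_z (a z.1 * b z.2)%:E =
  \int[m1]_x (a x)%:E * \int[m2]_y (b y)%:E)%E.
Proof.
have ia : m1.-integrable setT (EFin \o a) := @bounded_integrable R _ T1 m1 a 1 ma a1.
have ib : m2.-integrable setT (EFin \o b) := @bounded_integrable R _ T2 m2 b 1 mb b1.
have fb := integrable_fin_num measurableT ib.
rewrite -(integral12_prod_meas1 integrable_prod_mul) /fubini_F /=.
under eq_integral => x _.
  under eq_integral do rewrite EFinM.
  rewrite integralZl//.
  over.
by rewrite -(fineK fb) integralZr.
Qed.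
End product_integral.

(** * Integrals of characters over the torus *)

Section torus_integral.
Context {R : realType}.
Local Notation T := (measurableTypeR R).

(** Change of variables for the pushforward; boundedness and finite measure make the integrand
    integrable. *)
Lemma torus_integral_cons d (f : d.+1.-tuple T -> R) (c : R) :
  measurable_fun setT f -> (forall x, `|f x| <= c) ->
  (\int[torus_measure R d.+1]_x (f x)%:E =
   \int[(@circle_measure R \x torus_measure R d)]_z
     (f [the d.+1.-tuple T of z.1 :: z.2])%:E)%E.
Proof.
move=> mf fc.
pose h (x : T * d.-tuple T) : d.+1.-tuple T := [the d.+1.-tuple T of x.1 :: x.2].
have mh : measurable_fun setT h by exact: measurable_cons.
have mfE : measurable_fun setT (EFin \o f) by exact/measurable_EFinP.
have mfh : measurable_fun setT (fun z : T * d.-tuple T => (f (h z))%:E).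
  exact: measurableT_comp mfE mh.
have mab : measurable_fun setT (fun z : T * d.-tuple T => `|(f (h z))%:E|%E).
  exact: measurableT_comp.
have ih : (@circle_measure R \x torus_measure R d)%E.-integrable (h @^-1` setT)
    ((EFin \o f) \o h).
  rewrite preimage_setT; apply/integrable12ltyP => /=.
    exact: measurableT_comp.
  apply: (@le_lt_trans _ _
    (\int[@circle_measure R]_x cst (\int[torus_measure R d]_y cst c%:E y) x)%E).
    apply: ge0_le_integral => //.
    - by move=> x _; exact: integral_ge0.
    - exact: (measurable_fun_fubini_tonelli_F _ mab).
    - move=> x _; apply: ge0_le_integral => //.
        exact: measurableT_comp mab (pair1_measurable x).
      by move=> y _; rewrite lee_fin.
  rewrite integral_cst// integral_cst//.
  by rewrite ltey_eq !fin_numM// fin_num_measure.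
have := integral_pushforward mh mfE ih measurableT.
by rewrite preimage_setT => <-; exact: eq_measure_integral.
Qed.

Lemma measurable_cos_kdot d (k : d.-tuple int) :
  measurable_fun setT (fun x : d.-tuple T => cos (kdot k x)).
Proof. by have [] := @cmeasurable_torus_char R d k. Qed.

Lemma measurable_sin_kdot d (k : d.-tuple int) :
  measurable_fun setT (fun x : d.-tuple T => sin (kdot k x)).
Proof. by have [] := @cmeasurable_torus_char R d k. Qed.

(** Cosine and sine go through the induction together, since the addition formulas mix them. Every
    product containing a sine integrates to 0, and only cosine times cosine survives. *)
Lemma torus_integral_char d (k : d.-tuple int) :
  (\int[torus_measure R d]_x (cos (kdot k x))%:E =
     (\prod_(j < d) if tnth k j == 0 then 2 * pi else 0)%:E)%E /\
  (\int[torus_measure R d]_x (sin (kdot k x))%:E = 0)%E.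
Proof.
(* In dimension 0 the measure is a unit mass, and both the phase and the product are empty. *)
elim: d k => [|d IH] k.
  have k0 (x : 0.-tuple T) : kdot k x = 0 by rewrite /kdot big_ord0.
  under eq_integral do rewrite k0 cos0.
  rewrite (_ : (\int[_]_x (sin _)%:E = 0)%E); last first.
    by under eq_integral do rewrite k0 sin0; rewrite integral0.
  split=> //; rewrite integral_cst// big_ord0 mul1e.
  by rewrite /= diracT.
pose k0 := thead k; pose k' := [tuple of behead k].
have kE a (x : d.-tuple T) :
    kdot k [the d.+1.-tuple T of a :: x] = k0%:~R * a + kdot k' x.
  rewrite /kdot big_ord_recl tnth0; congr (_ + _); apply: eq_bigr => j _.
  by rewrite tnthS [in LHS](tuple_eta k) tnthS.
have [IHc IHs] := IH k'.
have m0 (g : R -> R) : continuous g -> measurable_fun setT (fun x : T => g (k0%:~R * x)).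
  move=> cg; apply: continuous_measurable_fun => x.
  by apply: (@continuous_comp _ _ _ _ g); [exact: mulrl_continuous|exact: cg].
have mc0 := m0 _ (@continuous_cos R); have ms0 := m0 _ (@continuous_sin R).
have mc := measurable_cos_kdot k'; have ms := measurable_sin_kdot k'.
have c1 x : `|cos x| <= 1 :> R by exact: cos_max.
have s1 x : `|sin x| <= 1 :> R by exact: sin_max.
have I := @integral_prod_mul _ _ T (d.-tuple T) R circle_measure (torus_measure R d).
have J := @integrable_prod_mul _ _ T (d.-tuple T) R circle_measure (torus_measure R d).
have Jcc := J _ _ mc0 mc (fun=> c1 _) (fun=> c1 _).
have Jss := J _ _ ms0 ms (fun=> s1 _) (fun=> s1 _).
have Jsc := J _ _ ms0 mc (fun=> s1 _) (fun=> c1 _).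
have Jcs := J _ _ mc0 ms (fun=> c1 _) (fun=> s1 _).
have Icc := I _ _ mc0 mc (fun=> c1 _) (fun=> c1 _).
have Iss := I _ _ ms0 ms (fun=> s1 _) (fun=> s1 _).
have Isc := I _ _ ms0 mc (fun=> s1 _) (fun=> c1 _).
have Ics := I _ _ mc0 ms (fun=> c1 _) (fun=> s1 _).
split.
  rewrite (torus_integral_cons (measurable_cos_kdot k) (fun=> c1 _)).
  under eq_integral do rewrite kE cosD EFinB.
  rewrite integralB//.
  rewrite Icc Iss circle_integral_cos circle_integral_sin IHc mul0e.
  rewrite sube0 -EFinM big_ord_recl; congr (_ * _)%:E.
  by apply: eq_bigr => j _; rewrite [in RHS](tuple_eta k) tnthS.
rewrite (torus_integral_cons (measurable_sin_kdot k) (fun=> s1 _)).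
under eq_integral do rewrite kE sinD EFinD.
rewrite integralD//.
by rewrite Isc Ics circle_integral_cos circle_integral_sin IHs mul0e mule0 adde0.
Qed.
End torus_integral.

(** * Parseval inequality *)

Section inner_product.
Context {R : realType} {d : nat}.
Local Notation T := (d.-tuple (measurableTypeR R)).
Local Notation mu := (torus_measure R d).
Implicit Types (f g h : T -> R[i]) (k l : d.-tuple int).

(** Linear in the first argument; the rules for the second are obtained through [innerC]. *)
Definition inner f g : R[i] := cintegral (fun x => f x * (g x)^*%C).

Definition sqnorm f : R := \int[mu]_x (normc (f x) ^+ 2).

Lemma integrable_normc_sqr f : square_integrable f ->
  mu.-integrable setT (fun x => (normc (f x) ^+ 2)%:E).
Proof.
move=> [mf fi]; apply/integrableP; split; first exact: measurable_normc_sqr.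
by under eq_integral do rewrite gee0_abs ?lee_fin ?sqr_ge0//.
Qed.

Lemma cmeasurable_conj f : cmeasurable f -> cmeasurable (fun x => (f x)^*%C).
Proof.
move=> [mr mi]; split.
  by rewrite (_ : (fun x => _) = (fun x => Re (f x)))//; apply/funext => x; case: (f x).
rewrite (_ : (fun x => _) = (fun x => - Im (f x))); first exact: measurableT_comp.
by apply/funext => x; case: (f x).
Qed.

(** Both parts of the product are bounded by [|f|^2 + |g|^2]; the squares of sums and differences of
    components are the certificates for [nra]. *)
Lemma cintegrable_mul_conj f g : square_integrable f -> square_integrable g ->
  cintegrable (fun x => f x * (g x)^*%C).
Proof.
move=> sf sg; have mfg := cmeasurableM sf.1 (cmeasurable_conj sg.1).
have ib := integrableD measurableT (integrable_normc_sqr sf) (integrable_normc_sqr sg).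
by split; (apply: le_integrable ib => //; first by apply/measurable_EFinP; have [] := mfg);
  move=> x _; rewrite /= !normc_sqr lee_fin [leRHS]ger0_norm ?addr_ge0 ?sqr_ge0//;
  rewrite ler_norml; case: (f x) => a b; case: (g x) => a' b' /=;
  have := sqr_ge0 (a - a'); have := sqr_ge0 (b - b'); have := sqr_ge0 (a + a');
  have := sqr_ge0 (b + b'); have := sqr_ge0 (a - b'); have := sqr_ge0 (b - a');
  have := sqr_ge0 (a + b'); have := sqr_ge0 (b + a');
  move=> *; apply/andP; split; nra.
Qed.

Lemma innerD f f' g : square_integrable f -> square_integrable f' ->
  square_integrable g -> inner (fun x => f x + f' x) g = inner f g + inner f' g.
Proof.
move=> sf sf' sg; rewrite /inner -cintegralD; try exact: cintegrable_mul_conj.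
by congr cintegral; apply/funext => x; rewrite mulrDl.
Qed.

Lemma innerZ (a : R[i]) f g : square_integrable f -> square_integrable g ->
  inner (fun x => a * f x) g = a * inner f g.
Proof.
move=> sf sg; rewrite /inner -cintegralZ; last exact: cintegrable_mul_conj.
by congr cintegral; apply/funext => x; rewrite mulrA.
Qed.

Lemma cintegral_conj f : cintegrable f ->
  cintegral (fun x => (f x)^*%C) = (cintegral f)^*%C.
Proof.
move=> [fr fi]; rewrite /cintegral /=; congr (_ +i* _).
  by apply: eq_Rintegral => x _; case: (f x).
rewrite -mulN1r -RintegralZl//; apply: eq_Rintegral => x _.
by rewrite mulN1r; case: (f x).
Qed.

Lemma innerC f g : square_integrable f -> square_integrable g ->
  inner f g = (inner g f)^*%C.
Proof.
move=> sf sg; rewrite /inner -cintegral_conj; last exact: cintegrable_mul_conj.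
by congr cintegral; apply/funext => x; rewrite rmorphM /= conjcK mulrC.
Qed.

Lemma inner_sqnorm f : inner f f = (sqnorm f)%:C.
Proof.
rewrite /inner /cintegral /sqnorm; congr (_ +i* _).
  by apply: eq_Rintegral => x _; rewrite normc_sqr; case: (f x) => a b /=; ring.
(* The imaginary part vanishes identically; the target 0 is written as an integral over the empty
   set so that both sides become [fine] of an extended integral. *)
rewrite -[RHS](@Rintegral_set0 _ _ _ mu (fun=> 0)) /Rintegral integral_set0.
rewrite integral0_eq// => x _; case: (f x) => a b /=.
by congr (_%:E); ring.
Qed.

Lemma sqnorm_ge0 f : 0 <= sqnorm f.
Proof. by apply: Rintegral_ge0 => x _; exact: sqr_ge0. Qed.

Lemma sqnormE f : square_integrable f ->
  (\int[mu]_x (normc (f x) ^+ 2)%:E = (sqnorm f)%:E)%E.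
Proof.
by move=> sf; rewrite /sqnorm /Rintegral fineK// integrable_fin_num// integrable_normc_sqr.
Qed.

Lemma square_integrable_sum (I : Type) (s : seq I) (F : I -> T -> R[i]) :
  (forall i, square_integrable (F i)) ->
  square_integrable (fun x => \sum_(i <- s) F i x).
Proof.
move=> sF; elim: s => [|i s IH].
  by under eq_fun do rewrite big_nil; exact: square_integrable0.
by under eq_fun do rewrite big_cons; exact: square_integrableD.
Qed.

Lemma inner_suml (I : Type) (s : seq I) (a : I -> R[i]) (F : I -> T -> R[i]) g :
  (forall i, square_integrable (F i)) -> square_integrable g ->
  inner (fun x => \sum_(i <- s) a i * F i x) g = \sum_(i <- s) a i * inner (F i) g.
Proof.
move=> sF sg; elim: s => [|i s IH].
  rewrite big_nil; under [X in inner X]eq_fun do rewrite big_nil -(mul0r 0).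
  by rewrite innerZ// ?mul0r//; exact: square_integrable0.
rewrite big_cons -IH -innerZ// -innerD//; last 2 first.
- exact: square_integrableZ.
- by apply: square_integrable_sum => j; exact: square_integrableZ.
by congr inner; apply/funext => x; rewrite big_cons.
Qed.

(** Pythagoras, computed with inner products in [R[i]] and brought back to [R] by injectivity of the
    embedding. *)
Lemma sqnormD f g : square_integrable f -> square_integrable g ->
  inner f g = 0 -> sqnorm (fun x => f x + g x) = sqnorm f + sqnorm g.
Proof.
move=> sf sg fg; apply: (@complexI R); rewrite rmorphD /= -!inner_sqnorm.
have sfg := square_integrableD sf sg.
have gf : inner g f = 0 by rewrite innerC// fg conjc0.
rewrite innerD// (innerC sf sfg) (innerC sg sfg) !innerD// fg gf addr0 add0r.
by rewrite !inner_sqnorm !conjc_real.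
Qed.

Definition fourier_basis k : T -> R[i] :=
  fun x => ((2 * pi) `^ (- (d%:R / 2)))%:C * torus_char k x.

Lemma square_integrable_torus_char k : square_integrable (@torus_char R d k).
Proof.
split; first exact: cmeasurable_torus_char.
under eq_integral do rewrite normc_sqr /= cos2Dsin2.
by rewrite integral_cst// mul1e ltey_eq fin_num_measure.
Qed.

Lemma square_integrable_fourier_basis k : square_integrable (fourier_basis k).
Proof. exact: square_integrableZ (square_integrable_torus_char k). Qed.

Lemma fourier_coef_inner k f : square_integrable f ->
  fourier_coef k f = inner f (fourier_basis k).
Proof.
move=> sf; rewrite /fourier_coef /inner -cintegralZ; last first.
  by apply: square_integrable_cintegrable; exact: square_integrable_char.
congr cintegral; apply/funext => x.
by rewrite rmorphM /= oppr0 -/(real_complex R _) /torus_char /= mulrCA.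
Qed.

(** The integrand is the character of frequency [k - l]; its integral is a product over the
    coordinates, with a factor 0 as soon as some coordinates differ. *)
Lemma inner_torus_char k l :
  inner (@torus_char R d k) (@torus_char R d l) = (if k == l then (2 * pi) ^+ d else 0)%:C.
Proof.
have E (x : T) : torus_char k x * (torus_char l x)^*%C =
    torus_char [tuple tnth k j - tnth l j | j < d] x.
  have -> : (torus_char l x)^*%C = torus_char [tuple - tnth l j | j < d] x.
    have kN : kdot [tuple - tnth l j | j < d] x = - kdot l x.
      rewrite /kdot -sumrN; apply: eq_bigr => j _.
      by rewrite tnth_mktuple intrN mulNr.
    by rewrite /torus_char kN sinN cosN.
  rewrite -torus_charM; congr (torus_char _ x).
  by apply: eq_from_tnth => j; rewrite !tnth_mktuple.
have [Ic Is] := @torus_integral_char R d [tuple tnth k j - tnth l j | j < d].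
rewrite /inner; under [X in cintegral X]eq_fun do rewrite E.
rewrite /cintegral /Rintegral /= Ic Is /=; congr (_ +i* _).
case: eqVneq => [->|kl].
  rewrite (eq_bigr (fun=> 2 * pi)) ?prodr_const ?card_ord// => j _.
  by rewrite tnth_mktuple subrr eqxx.
have [j kj] : exists j, tnth k j != tnth l j.
  apply/existsP; apply: contraR kl; rewrite negb_exists => /forallP H.
  by apply/eqP/eq_from_tnth => j; have := H j; rewrite negbK => /eqP.
by rewrite (bigD1 j)//= tnth_mktuple subr_eq0 (negPf kj) mul0r.
Qed.

Lemma fourier_basis_orthonormal k l :
  inner (fourier_basis k) (fourier_basis l) = (k == l)%:R.
Proof.
have sk := square_integrable_torus_char k; have sl := square_integrable_torus_char l.
rewrite innerZ//; last exact: square_integrable_fourier_basis.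
rewrite innerC//; last exact: square_integrable_fourier_basis.
rewrite innerZ// inner_torus_char rmorphM /= !oppr0 -!/(real_complex R _).
rewrite -!rmorphM /= eq_sym; case: eqVneq => _; last by rewrite !mulr0.
have p0 : 0 < 2 * pi :> R by rewrite mulr_gt0// pi_gt0.
have pn x : (x == 0 :> R) ==> (2 * pi != 0 :> R) by apply/implyP => _; rewrite (gt_eqF p0).
(* The exponents of [2 * pi] are [-d/2] twice, from the normalisation, and [d] from the volume; they
   add up to 0. *)
rewrite -powR_mulrn ?ltW// mulrA -!powRD ?pn//.
by rewrite (_ : _ + _ = 0) ?powRr0//; field.
Qed.

End inner_product.

(** * Fourier sums as best approximations *)

Section parseval.
Context {R : realType} {d : nat}.
Local Notation T := (d.-tuple (measurableTypeR R)).
Local Notation mu := (torus_measure R d).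
Implicit Types (f g h : T -> R[i]) (k l : d.-tuple int).

Let poly (q : seq (d.-tuple int * R[i])) : T -> R[i] :=
  fun x => \sum_(p <- q) p.2 * fourier_basis p.1 x.

Let square_integrable_poly q : square_integrable (poly q).
Proof.
apply: square_integrable_sum => p; apply: square_integrableZ.
exact: square_integrable_fourier_basis.
Qed.

Lemma inner_fourier_sum (s : seq (d.-tuple int)) (a : d.-tuple int -> R[i]) l :
  uniq s ->
  inner (fun x => \sum_(k <- s) a k * fourier_basis k x) (fourier_basis l) =
  if l \in s then a l else 0.
Proof.
move=> us; rewrite inner_suml; last 2 first.
- by move=> k; exact: square_integrable_fourier_basis.
- exact: square_integrable_fourier_basis.
under eq_bigr do rewrite fourier_basis_orthonormal.
case: ifPn => [ls|ls]; last first.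
  rewrite big_seq big1// => k ks; have [kl|_] := eqVneq k l; last by rewrite mulr0.
  by rewrite -kl ks in ls.
rewrite (bigD1_seq l)//= eqxx mulr1 big1 ?addr0// => k /negPf ->.
by rewrite mulr0.
Qed.

(* The Fourier sum over [s] is the best approximation by polynomials with
   frequencies in [s]. *)
Let sqnorm_le_dist f (s : seq (d.-tuple int)) q :
  square_integrable f -> uniq s -> {subset [seq p.1 | p <- q] <= s} ->
  sqnorm f <= \sum_(k <- s) normc (fourier_coef k f) ^+ 2 +
    sqnorm (fun x => f x - poly q x).
Proof.
move=> sf us qs.
pose c k := fourier_coef k f.
pose S : T -> R[i] := fun x => \sum_(k <- s) c k * fourier_basis k x.
have sS : square_integrable S.
  apply: square_integrable_sum => k; apply: square_integrableZ.
  exact: square_integrable_fourier_basis.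
(* The residual [r] is orthogonal to every basis function with frequency in [s], hence to all
   polynomials with these frequencies, including [S]. *)
pose r : T -> R[i] := fun x => f x + (-1) * S x.
have sr : square_integrable r.
  by apply: square_integrableD => //; exact: square_integrableZ.
have re l : l \in s -> inner r (fourier_basis l) = 0.
  move=> ls; have se := @square_integrable_fourier_basis R d l.
  rewrite /r innerD//; last exact: square_integrableZ.
  by rewrite innerZ// inner_fourier_sum// ls -fourier_coef_inner// mulN1r subrr.
have rp q' : {subset [seq p.1 | p <- q'] <= s} -> inner r (poly q') = 0.
  move=> q's; rewrite innerC// inner_suml//; last first.
    by move=> p; exact: square_integrable_fourier_basis.
  rewrite big_seq big1 ?conjc0// => p pq.
  rewrite innerC//; last exact: square_integrable_fourier_basis.
  by rewrite re ?conjc0 ?mulr0//; apply: q's; exact: map_f.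
have SE : S = poly [seq (k, c k) | k <- s].
  by apply/funext => x; rewrite /poly big_map.
have rS : inner r S = 0.
  by rewrite SE; apply: rp => k; rewrite -map_comp map_id.
have nS : sqnorm S = \sum_(k <- s) normc (c k) ^+ 2.
  apply: (@complexI R); rewrite -inner_sqnorm {1}/S inner_suml//; last first.
    by move=> k; exact: square_integrable_fourier_basis.
  rewrite rmorph_sum big_seq [RHS]big_seq; apply: eq_bigr => k ks.
  rewrite innerC//; last exact: square_integrable_fourier_basis.
  rewrite inner_fourier_sum// ks normc_sqr; case: (c k) => a b.
  by apply/eqP; rewrite eq_complex /=; apply/andP; split; apply/eqP; ring.
have fE x : f x = r x + S x by rewrite /r mulN1r subrK.
rewrite (_ : sqnorm f = sqnorm (fun x => r x + S x)); last first.
  by congr sqnorm; exact/funext.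
rewrite sqnormD// nS addrC lerD2l.
(* The difference [S - poly q] is again a polynomial with frequencies in [s], so Pythagoras applied
   to [f - poly q = r + (S - poly q)] bounds the norm of [r]. *)
pose q' := [seq (k, c k) | k <- s] ++ [seq (p.1, - p.2) | p <- q].
have -> : (fun x => f x - poly q x) = (fun x => r x + poly q' x).
  apply/funext => x; rewrite fE -addrA; congr (_ + _).
  rewrite /poly big_cat !big_map -sumrN; congr (_ + _).
  by apply: eq_bigr => p _; rewrite mulNr.
rewrite sqnormD//; first by rewrite lerDl sqnorm_ge0.
apply: rp => k; rewrite /q' map_cat mem_cat -!map_comp => /orP[|].
  by rewrite map_id.
exact: qs.
Qed.

(** A polynomial within [e] of [f] has finitely many frequencies; [sqnorm_le_dist] bounds the
    squared norm by the partial sum over them plus [e]. *)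
Lemma sqnorm_le_fourier_sum f : square_integrable f ->
  ((sqnorm f)%:E <=
   \esum_(k in [set: d.-tuple int]) (normc (fourier_coef k f) ^+ 2)%:E)%E.
Proof.
move=> sf; apply/lee_addgt0Pr => e e0.
have [mf /(_ e e0)[t tt ft]] := approximable_square_integrable sf.
have mt := trig_poly_cmeasurable tt.
have [q0 tE] := tt.
have p0 : 0 < 2 * pi :> R by rewrite mulr_gt0// pi_gt0.
pose w : R := (2 * pi) `^ (- (d%:R / 2)).
have w0 : w%:C != 0 :> R[i].
  by rewrite -(rmorph0 (real_complex R)) (inj_eq (@complexI R)) gt_eqF// powR_gt0.
(* Dividing by the normalising factor rewrites the polynomial in the orthonormal basis. *)
pose q := [seq (p.1, p.2 / w%:C) | p <- q0].
have tq : t = poly q.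
  apply/funext => x; rewrite tE /poly big_map; apply: eq_bigr => p _.
  by rewrite /fourier_basis -/w mulrA divfK.
have sft : square_integrable (fun x => f x - t x).
  rewrite tq; under eq_fun do rewrite -mulN1r.
  by apply: square_integrableD => //; exact: square_integrableZ.
have us := undup_uniq [seq p.1 | p <- q].
have qs : {subset [seq p.1 | p <- q] <= undup [seq p.1 | p <- q]}.
  by move=> k; rewrite mem_undup.
have := sqnorm_le_dist sf us qs; rewrite -tq -lee_fin EFinD => /le_trans; apply.
apply: leeD; last by rewrite -sqnormE//; exact: ltW.
apply: ereal_sup_ubound; exists [set` undup [seq p.1 | p <- q]].
  by split => //; exact: finite_seq.
by rewrite -fsbig_seq// sumEFin.
Qed.
End parseval.

(** * Fourier coefficients and Fourier sums of classes of functions *)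

Section fourier_L2.
Context {R : realType} {d : nat}.
Local Notation T := (d.-tuple (measurableTypeR R)).
Local Notation mu := (torus_measure R d).
Implicit Types (k l : d.-tuple int) (u v : L2 R d).
Local Open Scope quotient_scope.

Lemma L2norm_le_fourier_sum u :
  ((L2norm u ^+ 2)%:E <=
   \esum_(k in [set: d.-tuple int]) (normc (L2coef k u) ^+ 2)%:E)%E.
Proof.
rewrite /L2norm sqr_sqrtr; last by apply: Rintegral_ge0 => x _; exact: sqr_ge0.
exact: sqnorm_le_fourier_sum (square_integrableP (repr u)).
Qed.

Definition fourier_basis_L2fun k : @L2fun R d :=
  MkL2fun (introT (asboolP _) (square_integrable_fourier_basis k)).

Definition L2_basis k : L2 R d := \pi_(L2 R d) (fourier_basis_L2fun k).

(** The representative of the class is the basis function only almost everywhere, hence the detour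
    through [ae_eq_cintegral]. *)
Lemma L2coef_basis k l : L2coef l (L2_basis k) = (k == l)%:R.
Proof.
rewrite -fourier_basis_orthonormal -fourier_coef_inner; last first.
  exact: square_integrable_fourier_basis.
rewrite /L2coef /fourier_coef; congr (_ * _); apply: ae_eq_cintegral.
- by have [] := square_integrable_char l (square_integrableP (repr (L2_basis k))).
- by have [] := square_integrable_char l (@square_integrable_fourier_basis R d k).
- by apply: filterS (repr_piE (fourier_basis_L2fun k)) => x ->.
Qed.

Lemma L2coef_sum (I : Type) (s : seq I) (F : I -> L2 R d) l :
  L2coef l (\sum_(i <- s) F i) = \sum_(i <- s) L2coef l (F i).
Proof.
elim: s => [|i s IH]; last by rewrite !big_cons L2coefD IH.
by rewrite !big_nil -(scale0r (0 : L2 R d)) L2coefZ mul0r.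
Qed.

Definition fourier_sum (s : seq (d.-tuple int)) u : L2 R d :=
  \sum_(k <- s) L2coef k u *: L2_basis k.

Lemma L2coef_fourier_sum (s : seq (d.-tuple int)) u l : uniq s ->
  L2coef l (fourier_sum s u) = if l \in s then L2coef l u else 0.
Proof.
move=> us; rewrite L2coef_sum.
under eq_bigr do rewrite L2coefZ L2coef_basis.
case: ifPn => [ls|ls]; last first.
  rewrite big_seq big1// => k ks; have [kl|_] := eqVneq k l; last by rewrite mulr0.
  by rewrite -kl ks in ls.
rewrite (bigD1_seq l)//= eqxx mulr1 big1 ?addr0// => k /negPf ->.
by rewrite mulr0.
Qed.

(** Puts the basis elements into the range of the truncation, since [dim_lt] requires spanning
    elements from the space itself. *)
Lemma fourier_sum_basis (s : seq (d.-tuple int)) k : uniq s -> k \in s ->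
  fourier_sum s (L2_basis k) = L2_basis k.
Proof.
move=> us ks; rewrite /fourier_sum.
under eq_bigr do rewrite L2coef_basis.
rewrite (bigD1_seq k)//= eqxx scale1r big1 ?addr0// => l /negPf lk.
by rewrite eq_sym lk scale0r.
Qed.
End fourier_L2.

(** * Truncated Fourier series as an operator *)

Lemma le_esum_scale {R : realType} {I : choiceType} (c : R) (f g : I -> \bar R) :
  0 <= c -> (forall i, 0 <= g i)%E -> (forall i, f i <= c%:E * g i)%E ->
  (\esum_(i in [set: I]) f i <= c%:E * \esum_(i in [set: I]) g i)%E.
Proof.
move=> c0 g0 fg; apply: ub_ereal_sup => _ [X [fX _] <-].
apply: (@le_trans _ _ (\sum_(i \in X) c%:E * g i)%E).
  rewrite !fsbig_finite//; exact: lee_sum.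
rewrite -ge0_mule_fsumr; last exact: g0.
by apply: lee_wpmul2l; [rewrite lee_fin|apply: ereal_sup_ubound; exists X].
Qed.

Section fourier_operator.
Context {R : realType} {d : nat} (s : R).
Variable F : seq (d.-tuple int).
Local Notation weight k := (\prod_(j < d) (1 + `|tnth k j|%:~R : R)).

Definition fourier_op (u : Hmix d s) : L2 R d := fourier_sum F (Hmix_val u).

Lemma fourier_op_is_linear : linear fourier_op.
Proof.
move=> a u v; rewrite /fourier_op /fourier_sum scaler_sumr -big_split /=.
by apply: eq_bigr => k _; rewrite L2coefD L2coefZ scalerDl scalerA.
Qed.

HB.instance Definition _ := GRing.isLinear.Build R[i] (Hmix d s) (L2 R d) _
  fourier_op fourier_op_is_linear.

Lemma weight_powR (k : d.-tuple int) :
  \prod_(j < d) (1 + `|tnth k j|%:~R : R) `^ (2 * s) = weight k `^ (2 * s).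
Proof. by rewrite prodr_powR// => j; rewrite addr_ge0. Qed.

(** A comparison of coefficients passes to norms by the Parseval inequality. Used with [c = 1] for
    boundedness and with [c = r^-s] for the error. *)
Lemma L2norm_le_Hmix (c : R) (u : Hmix d s) (v : L2 R d) : 0 <= c ->
  (forall k, normc (L2coef k v) ^+ 2 <=
     c ^+ 2 * (normc (L2coef k (Hmix_val u)) ^+ 2 * weight k `^ (2 * s))) ->
  L2norm v <= c * Hmix_norm u.
Proof.
move=> c0 cuv; have fu : (Hmix_sum s (Hmix_val u) < +oo)%E := valP u.
have h0 : (0 <= Hmix_sum s (Hmix_val u))%E.
  by apply: esum_ge0 => k _; exact: Hmix_term_ge0.
(* The sum is finite by membership in [Hmix], so [fine] in the norm loses nothing. *)
have hE : Hmix_sum s (Hmix_val u) = (Hmix_norm u ^+ 2)%:E.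
  by rewrite /Hmix_norm sqr_sqrtr ?fine_ge0// fineK// ge0_fin_numE.
rewrite -(@ler_pXn2r _ 2)// ?nnegrE ?mulr_ge0 ?sqrtr_ge0//.
rewrite exprMn -lee_fin (le_trans (L2norm_le_fourier_sum v))// EFinM -hE.
apply: le_esum_scale; first exact: sqr_ge0.
  by move=> k; exact: Hmix_term_ge0.
by move=> k; rewrite /Hmix_term -EFinM lee_fin weight_powR.
Qed.

Lemma Hmix_basis_subproof (k : d.-tuple int) :
  L2_basis k \in Hmix_pred s.
Proof.
rewrite inE /Hmix_sum.
rewrite (_ : \esum_(l in setT) _ =
    \esum_(l in [set k]) Hmix_term s (@L2_basis R d k) l)%E.
  by rewrite esum_set1 ?ltry ?Hmix_term_ge0.
rewrite [RHS]esum_mkcond; apply: eq_esum => l _.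
rewrite in_set1; case: eqVneq => [//|lk].
by rewrite /Hmix_term L2coef_basis eq_sym (negPf lk) normc0 expr0n mul0r.
Qed.

Definition Hmix_basis k : Hmix d s := MkHmix (Hmix_basis_subproof k).

Lemma fourier_op_rank (n : nat) : uniq F -> (size F < n)%N ->
  rank_lt fourier_op n.
Proof.
move=> uF Fn; exists (size F), (fun i => L2_basis (tnth (in_tuple F) i)); split=> //.
  move=> i; exists (Hmix_basis (tnth (in_tuple F) i)) => //.
  by apply: fourier_sum_basis => //; exact: mem_tnth.
move=> _ [u _ <-]; exists (fun i => L2coef (tnth (in_tuple F) i) (Hmix_val u)).
exact: (big_tnth _ _ F).
Qed.

Lemma weight_ge1 (k : d.-tuple int) : 1 <= weight k.
Proof.
elim/big_ind: _ => [|x y|i _]; [exact: lexx|exact: mulr_ege1|].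
by rewrite lerDl.
Qed.

Lemma fourier_op_bounded : 0 < s -> uniq F ->
  bounded_op (@Hmix_norm R d s) (@L2norm R d) fourier_op.
Proof.
(* The constant 1 works because truncation only deletes coefficients and every weight is at least
   1. *)
move=> s0 uF; exists 1 => u; apply: L2norm_le_Hmix => // k.
have w1 : 1 <= weight k `^ (2 * s).
  rewrite -[leLHS](powRr0 (weight k)); apply: ler_powR; first exact: weight_ge1.
  by rewrite mulr_ge0// ltW.
rewrite expr1n mul1r L2coef_fourier_sum//; case: ifP => _.
  by rewrite ler_peMr// sqr_ge0.
by rewrite normc0 expr0n mulr_ge0 ?sqr_ge0// (le_trans ler01).
Qed.

(** The error has no coefficients in [F]; outside [F] the weight is at least [r], so
    [1 <= r^(-2s) w^(2s)]. *)
Lemma fourier_op_error (r : R) : 0 < s -> 0 < r -> uniq F ->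
  (forall k, (k \in F) = (weight k < r)) ->
  (opnorm (@Hmix_norm R d s) (@L2norm R d)
     (fun u => Hmix_embedding d s u - fourier_op u)%R <= (r `^ (- s))%:E)%E.
Proof.
move=> s0 r0 uF FE; apply: ub_ereal_sup => _ [u /= u1 <-]; rewrite lee_fin.
apply: (@le_trans _ _ (r `^ (- s) * Hmix_norm u)); last first.
  by rewrite ler_piMr// powR_ge0.
apply: L2norm_le_Hmix => [|k]; first exact: powR_ge0.
rewrite -scaleN1r L2coefD L2coefZ L2coef_fourier_sum// FE.
have n0 := sqr_ge0 (normc (L2coef k (Hmix_val u))).
have w1 := weight_ge1 k.
case: ltP => rk.
  rewrite mulN1r subrr normc0 expr0n.
  by rewrite mulr_ge0 ?sqr_ge0// mulr_ge0// powR_ge0.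
rewrite mulr0 addr0 mulrCA ler_peMr//.
rewrite -powR_mulrn ?powR_ge0// -powRrM.
have -> : r `^ (- s * 2) = (r `^ (2 * s))^-1 by rewrite -powRN; congr (_ `^ _); ring.
rewrite ler_pdivlMl ?powR_gt0// mulr1; apply: ge0_ler_powR => //.
- by rewrite mulr_ge0// ltW.
- by rewrite nnegrE ltW.
- by rewrite nnegrE (le_trans ler01).
Qed.
End fourier_operator.

(** * The upper bound for the approximation numbers *)

Theorem theorem4p9 (R : realType) (s : R) (d n : nat)
    (hs : 0 < s) (hd : (2 <= d)%N) (hn1 : (1 <= n)%N)
    (hn2 : n%:R <= d%:R / 2 * 4 ^+ d :> R) :
  (approx_number (@Hmix_norm R d s) (@L2norm R d) (@Hmix_embedding R d s) n
   <= ((expR 2 / n%:R) `^ (s / (2 + ln d%:R / ln 2)))%:E)%E.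
Proof.
have n0 : 0 < n%:R :> R by rewrite ltr0n.
have d0 : (0 < d)%N by exact: leq_trans hd.
set a := 2 + _.
have a0 : 0 < a.
  have : 0 <= ln d%:R / ln 2 :> R.
    by apply: divr_ge0; apply: ln_ge0; rewrite ?ler1n// ler1n.
  by rewrite /a; lra.
have q0 : 0 < n%:R / expR 2 :> R by rewrite divr_gt0// expR_gt0.
pose r : R := (n%:R / expR 2) `^ a^-1.
have r0 : 0 < r by exact: powR_gt0.
have [F [uF FE Fn]] := hyperbolic_cross_card d0 r0.
(* With this [r] the count is bounded by [e^2 r^a = n], and its strictness is exactly the
   requirement that the rank be less than [n]. *)
have {}Fn : (size F < n)%N.
  move: Fn; rewrite -/a /r -powRrM mulVf ?gt_eqF// powRr1 ?ltW// mulrC divfK.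
    by rewrite ltr_nat.
  by rewrite gt_eqF// expR_gt0.
have -> : (expR 2 / n%:R) `^ (s / a) = r `^ (- s).
  have -> : expR 2 / n%:R = (n%:R / expR 2) `^ (-1) :> R.
    by rewrite powRN powRr1 ?invf_div ?ltW.
  rewrite /r -!powRrM.
  by congr (_ `^ _); field; rewrite gt_eqF.
apply: le_trans (fourier_op_error hs r0 uF FE).
apply: ereal_inf_lbound; exists (fourier_op (s := s) F : {linear _ -> _}) => //.
by split; [exact: fourier_op_bounded|exact: fourier_op_rank].
Qed.
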